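(* Let $(D,X)$ be a Dyer system and let $Y,Y'\subseteq X$. Then $$\operatorname{Conj}(D_Y,D_{Y'})=\operatorname{Ribb}(Y,Y')\cdot D_Y .$$
   Context: A Dyer graph is a finite simplicial graph $\Gamma$ with vertex set $V(\Gamma)$ and edge set $E(\Gamma)$, together with a vertex labelling $f\colon V(\Gamma)\to\mathbb{N}_{\geq 2}\cup\{\infty\}$ and an edge labelling $m\colon E(\Gamma)\to\mathbb{N}_{>2}\cup\{\infty\}$ such that for every edge $\{u,v\}\in E(\Gamma)$, if $f(v)\geq 3$ (including $f(v)=\infty$), then $m(u,v)=\infty$. The labelling $m$ is extended to all pairs of distinct vertices by $m(u,v)=2$ if $\{u,v\}\notin E(\Gamma)$. The associated Dyer group is $$D(\Gamma)=\langle V(\Gamma)\mid v^{f(v)}=1 \text{ for all } v \text{ with } f(v)<\infty,\ \underbrace{uvu\cdots}_{m(u,v)\text{ terms}}=\underbrace{vuv\cdots}_{m(u,v)\text{ terms}}\text{ for all } \{u,v\}\text{ with } m(u,v)\neq\infty\rangle.$$ A Dyer system is a pair $(D,X)$ where $D$ is a group and $X\subseteq D$ is a generating set such that there exist a Dyer graph $\Gamma$ and a group isomorphism $D(\Gamma)\to D$ mapping $V(\Gamma)$ bijectively onto $X$. For $Y\subseteq X$, $D_Y$ denotes the subgroup of $D$ generated by $Y$, and $\Gamma_Y$ the full subgraph of $\Gamma$ spanned by (the vertices corresponding to) $Y$; $D_Y$ is the Dyer group of $\Gamma_Y$. The order of an element $x$ is denoted $o(x)$. Set $$\operatorname{Conj}(D_Y,D_{Y'})=\{g\in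 D\mid gD_Yg^{-1}=D_{Y'}\}.$$ Spherical type: a Dyer group is of spherical type if its Dyer graph has no edge labelled $\infty$ and the subgroup generated by its standard generators of order $2$ (a Coxeter group) is finite. Ribbons: let $Y\subseteq X$ and $x\in X\setminus Y$, and let $\Gamma_U$ (with $U\subseteq Y\cup\{x\}$) be the connected component of $\Gamma_{Y\cup\{x\}}$ containing $x$. If $D_U$ is of spherical type, define $$r_{Y,x}=\begin{cases} w_U^{-1}w_{U\setminus\{x\}} & \text{if } o(x)=2,\\ x & \text{if } o(x)>2 \text{ (in which case } U=\{x\}),\end{cases}$$ where, for $o(x)=2$, all elements of $U$ have order $2$, $D_U$ is a finite Coxeter group, and $w_U$, $w_{U\setminus\{x\}}$ are the elements of maximal length in the finite Coxeter groups $D_U$, $D_{U\setminus\{x\}}$. There is a unique $Z\subseteq Y\cup\{x\}$ with $r_{Y,x}D_Yr_{Y,x}^{-1}=D_Z$; the element $r_{Y,x}$ is called an elementary $(Y,Z)$-ribbon, and $r_{Y,x}^{-1}$ is called an elementary $(Z,Y)$-ribbon. A $(Y,Y')$-ribbon is an element $r=r_q\cdots r_1$ such that there is a sequence $Y=Y^1,\dots,Y^{q+1}=Y'$ of subsets of $X$ for which each $r_i$ is an elementary $(Y^i,Y^{i+1})$-ribbon; the empty product ($q=0$) is allowed, so $1$ is a $(Y,Y)$-ribbon. $\operatorname{Ribb}(Y,Y')$ is the set of all $(Y,Y')$-ribbons. *)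

(* Defs.v *)
From HB Require Import structures.
From mathcomp Require Import all_boot generic_quotient.
From mathcomp Require Import boolp classical_sets functions cardinality.

Set Implicit Arguments.
Unset Strict Implicit.
Unset Printing Implicit Defensive.

Local Open Scope classical_set_scope.
Local Open Scope quotient_scope.
Local Open Scope group_scope.

(* Elements of N u {oo} are encoded as [option nat], with [None] for oo. *)
Definition ltn_inf (k : nat) (a : option nat) : bool :=
  if a is Some n then (k < n)%N else true.

(* The letter [(v, true)] stands for v and [(v, false)] for v^-1; [R s t] is
   the defining relation s = t. *)
Section Presentation.
Variables (V : choiceType) (R : seq (V * bool) -> seq (V * bool) -> Prop).
Local Notation word := (seq (V * bool)).

Inductive pres_eq : word -> word -> Prop :=
| PresRefl s : pres_eq s s
| PresSym s t : pres_eq s t -> pres_eq t s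
| PresTrans s t u : pres_eq s t -> pres_eq t u -> pres_eq s u
| PresCat s s' t t' : pres_eq s s' -> pres_eq t t' -> pres_eq (s ++ t) (s' ++ t')
| PresCancel v b : pres_eq [:: (v, b); (v, ~~ b)] [::]
| PresRel s t : R s t -> pres_eq s t.

Definition pres_eqb : rel word := fun s t => `[< pres_eq s t >].

Lemma pres_eqb_equiv : equiv_class_of pres_eqb.
Proof.
split=> [s|s t|t s u /asboolP st /asboolP tu]; first exact/asboolP/PresRefl.
  by apply/asboolP/asboolP; exact: PresSym.
exact/asboolP/(PresTrans st tu).
Qed.

Canonical pres_eqb_equiv_rel := EquivRelPack pres_eqb_equiv.

Definition presented := {eq_quot pres_eqb_equiv_rel}.
HB.instance Definition _ := Choice.on presented.
HB.instance Definition _ := EqQuotient.on presented.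

Definition winv (s : word) : word := [seq (l.1, ~~ l.2) | l <- rev s].

Lemma winv_cat s t : winv (s ++ t) = winv t ++ winv s.
Proof. by rewrite /winv rev_cat map_cat. Qed.

Lemma winvK : involutive winv.
Proof.
move=> s; rewrite /winv -map_rev revK -map_comp -[RHS]map_id.
by apply: eq_map => -[v b] /=; rewrite negbK.
Qed.

Lemma pres_eq_mulwV s : pres_eq (s ++ winv s) [::].
Proof.
elim: s => [|[v b] s IHs]; first exact: PresRefl.
rewrite -cat1s winv_cat -catA (catA s).
apply: PresTrans (PresCancel v b).
apply: (PresCat (PresRefl [:: (v, b)]) (t' := [:: (v, ~~ b)])).
exact: (PresCat IHs (PresRefl [:: (v, ~~ b)])).
Qed.

Lemma pres_eq_mulVw s : pres_eq (winv s ++ s) [::].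
Proof. by have := pres_eq_mulwV (winv s); rewrite winvK. Qed.

Lemma pres_eq_inv s t : pres_eq s t -> pres_eq (winv s) (winv t).
Proof.
move=> st; rewrite -[winv s]cats0.
apply: PresTrans (PresCat (PresRefl _) (PresSym (pres_eq_mulwV t))) _.
rewrite catA; apply: (PresCat (t := winv t) (s' := [::]) _ (PresRefl _)).
apply: PresTrans (PresCat (PresRefl _) (PresSym st)) (pres_eq_mulVw s).
Qed.

Definition presC (s : word) : presented := \pi s.

Lemma presCP s t : presC s = presC t <-> pres_eq s t.
Proof. by split=> [/eqmodP/asboolP|st]; last exact/eqmodP/asboolP. Qed.

Lemma pres_reprK (a : presented) : presC (repr a) = a.
Proof. exact: reprK. Qed.

Lemma pres_eq_repr s : pres_eq (repr (presC s)) s.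
Proof. by apply/presCP; rewrite pres_reprK. Qed.

Definition pres_mul (a b : presented) : presented := presC (repr a ++ repr b).
Definition pres_one : presented := presC [::].
Definition pres_inv (a : presented) : presented := presC (winv (repr a)).

Lemma pres_mulA : associative pres_mul.
Proof.
move=> a b c; apply/presCP.
apply: PresTrans (PresCat (PresRefl _) (pres_eq_repr _)) _.
by rewrite catA; exact: PresCat (PresSym (pres_eq_repr _)) (PresRefl _).
Qed.

Lemma pres_mul1 : left_id pres_one pres_mul.
Proof.
move=> a; rewrite -[RHS]pres_reprK; apply/presCP.
exact: (PresCat (pres_eq_repr [::]) (PresRefl (repr a))).
Qed.

Lemma pres_mulx1 : right_id pres_one pres_mul.
Proof.
move=> a; rewrite -[RHS]pres_reprK; apply/presCP.
by have := PresCat (PresRefl (repr a)) (pres_eq_repr [::]); rewrite cats0.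
Qed.

Lemma pres_mulV : left_inverse pres_one pres_inv pres_mul.
Proof.
move=> a; apply/presCP.
exact: PresTrans (PresCat (pres_eq_repr _) (PresRefl _)) (pres_eq_mulVw _).
Qed.

Lemma pres_mulxV : right_inverse pres_one pres_inv pres_mul.
Proof.
move=> a; apply/presCP.
exact: PresTrans (PresCat (PresRefl _) (pres_eq_repr _)) (pres_eq_mulwV _).
Qed.

HB.instance Definition _ := isGroup.Build presented
  pres_mulA pres_mul1 pres_mulx1 pres_mulV pres_mulxV.

Definition pres_gen (v : V) : presented := presC [:: (v, true)].

End Presentation.

(* [dg_m] is only meaningful on edges; [dg_label] is the extension of the edge
   labelling to all pairs of distinct vertices. *)
Record dyer_graph := DyerGraph {
  dg_V :> finType;
  dg_edge : rel dg_V;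
  dg_f : dg_V -> option nat;
  dg_m : dg_V -> dg_V -> option nat;
  dg_edge_sym : symmetric dg_edge;
  dg_edge_irr : irreflexive dg_edge;
  dg_m_sym : forall u v, dg_edge u v -> dg_m u v = dg_m v u;
  dg_f_ge2 : forall v, ltn_inf 1 (dg_f v);
  dg_m_gt2 : forall u v, dg_edge u v -> ltn_inf 2 (dg_m u v);
  dg_f_m : forall u v, dg_edge u v -> ltn_inf 2 (dg_f v) -> dg_m u v = None
}.

Definition dg_label (G : dyer_graph) (u v : G) : option nat :=
  if dg_edge u v then dg_m u v else Some 2.

(* the word u v u ... with n letters *)
Fixpoint alt (V : Type) (n : nat) (u v : V) : seq (V * bool) :=
  if n is k.+1 then (u, true) :: alt k v u else [::].

Inductive dyer_rel (G : dyer_graph) : seq (G * bool) -> seq (G * bool) -> Prop :=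
| DyerPow (v : G) n : dg_f v = Some n -> dyer_rel (nseq n (v, true)) [::]
| DyerBraid (u v : G) n : u != v -> dg_label u v = Some n ->
    dyer_rel (alt n u v) (alt n v u).

Definition dyer_group (G : dyer_graph) : groupType := presented (@dyer_rel G).

Definition dyer_gen (G : dyer_graph) (v : G) : dyer_group G :=
  pres_gen (@dyer_rel G) v.

Section Subgroups.
Variable D : groupType.

Definition is_subgroup (H : set D) : Prop :=
  H 1 /\ forall x y, H x -> H y -> H (x / y).

Definition gen_by (Y : set D) : set D := smallest is_subgroup Y.

Definition conj_by (g : D) (H : set D) : set D := [set g * h * g^-1 | h in H].

Definition Conj (Y Y' : set D) : set D :=
  [set g | conj_by g (gen_by Y) = gen_by Y'].

Definition elt_order (x : D) : option nat :=
  if pselect (exists n, (0 < n)%N && (x ^+ n == 1)) is left ex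
  then Some (ex_minn ex) else None.

Definition word_in (U : set D) (g : D) (n : nat) : Prop :=
  exists s : n.-tuple D, (forall y, y \in s -> U y) /\ g = \prod_(y <- s) y.

(* Only positive words in U are considered, as is usual for Coxeter groups;
   the value 0 outside the submonoid generated by U is a dummy. *)
Definition word_length (U : set D) (g : D) : nat :=
  if pselect (exists n, `[< word_in U g n >]) is left ex then ex_minn ex else 0.

Definition longest (U : set D) (w : D) : Prop :=
  gen_by U w /\
  forall g, gen_by U g -> (word_length U g <= word_length U w)%N.

End Subgroups.

Record dyer_system (D : groupType) (X : set D) := DyerSystem {
  ds_graph : dyer_graph;
  ds_iso : {multiplicative dyer_group ds_graph -> D};
  ds_isoP : bijective ds_iso;
  ds_vertP : set_bij [set: ds_graph] X (fun v => ds_iso (dyer_gen v));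
  ds_genP : gen_by X = [set: D]
}.

Section Ribbons.
Variables (D : groupType) (X : set D) (S : dyer_system X).
Local Notation G := (ds_graph S).

Definition ds_vert (v : G) : D := ds_iso S (dyer_gen v).

(* adjacency in the full subgraph spanned by Z *)
Definition full_edge (Z : set D) : rel G :=
  fun u v => [&& dg_edge u v, ds_vert u \in Z & ds_vert v \in Z].

(* the component of x in the full subgraph spanned by Z, for x in Z *)
Definition component (Z : set D) (x : D) : set D :=
  [set y | exists u v : G,
     [/\ x = ds_vert u, y = ds_vert v & connect (full_edge Z) u v]].

(* D_U is of spherical type: D_U is the Dyer group of the full subgraph spanned
   by U, and the subgroup generated by its standard generators of order 2 is
   computed inside D. *)
Definition spherical (U : set D) : Prop :=
  (forall u v : G, full_edge U u v -> dg_m u v <> None) /\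
  finite_set (gen_by [set y | U y /\ elt_order y = Some 2]).

(* r is the element r_{Y,x}, which is required to be defined; w and w' are the
   elements of maximal length of D_U and of D_{U \ {x}}. *)
Definition is_ribbon_elt (Y : set D) (x r : D) : Prop :=
  let U := component (x |` Y) x in
  spherical U /\
  ((elt_order x = Some 2 /\
    exists w w', [/\ longest U w, longest (U `\ x) w' & r = w^-1 * w'])
   \/ (ltn_inf 2 (elt_order x) /\ r = x)).

Definition direct_ribbon (Y Z : set D) (r : D) : Prop :=
  Y `<=` X /\
  exists x, [/\ X x, ~ Y x, is_ribbon_elt Y x r,
               Z `<=` x |` Y & conj_by r (gen_by Y) = gen_by Z].

Definition elementary_ribbon (Y Z : set D) (r : D) : Prop :=
  direct_ribbon Y Z r \/ direct_ribbon Z Y r^-1.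

Inductive ribbon (Y : set D) : set D -> D -> Prop :=
| RibbonNil : Y `<=` X -> ribbon Y Y 1
| RibbonCons Z Z' r s : ribbon Y Z r -> elementary_ribbon Z Z' s ->
    ribbon Y Z' (s * r).

Definition Ribb (Y Y' : set D) : set D := [set r | ribbon Y Y' r].

End Ribbons.

(* Main.v *)
(* Writing g = x_1^a_1 ... x_k^a_k with x_i in X and p_i for the product of the
   first i - 1 syllables, let N(g) be the formal sum of the a_i [p_i x_i p_i^-1],
   where the coefficient of a conjugate of x is taken modulo the order of x.
   Then N is well defined and is a 1-cocycle.  It yields the exchange condition
   and unique shortest representatives k of the cosets D_Y k, characterised by
   N(k) vanishing on D_Y, with lengths adding up in D_Y k.

   Let k^-1 conjugate D_Y to D_Y' with k shortest in D_Y k; then k^-1 Y k = Y'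
   by comparing lengths.  If x is a left descent of k, split off j in D_(Y + x)
   with k = j k' and k' shortest in D_(Y + x) k'.  Again j^-1 Y j is a subset of
   Y + x, and induction applies to k'.  As N(j) is invariant under conjugation by
   D_Y, the D_Y-orbit of x is finite; hence D_(U - x) is finite, where U is the
   component of x.  If w' is longest in D_(U - x), then every element of U is a
   descent of w' j, which is therefore longest in D_U, and j^-1 = (w' j)^-1 w' is
   an elementary ribbon.

   The label m(u,v) enters only through two facts on an edge u - v: the
   generators do not commute, and no element has both as descents if
   m(u,v) = oo.  They need models of D, namely Tits' representation and an
   ad hoc permutation action respectively. *)

Require Import Defs.
From HB Require Import structures.
From mathcomp Require Import all_boot all_algebra algC cyclotomic ring.
From mathcomp Require Import boolp classical_sets functions cardinality.

Set Implicit Arguments.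
Unset Strict Implicit.
Unset Printing Implicit Defensive.
Import GRing.Theory.

Local Open Scope classical_set_scope.
Local Open Scope group_scope.

(** * Groups and words *)

Section GroupGeneralities.
Variable D : groupType.
Implicit Types (H Y U : set D) (g h x t : D).

Lemma gen_by_sub Y : Y `<=` gen_by Y.
Proof. exact: sub_gen_smallest. Qed.

Lemma gen_by_min Y H : is_subgroup H -> Y `<=` H -> gen_by Y `<=` H.
Proof. exact: smallest_sub. Qed.

Lemma gen_by_subgroup Y : is_subgroup (gen_by Y).
Proof.
split=> [H [[H1 _] _] //|x y Hx Hy H HH].
by have [[_ Hd] _] := HH; apply: Hd; [exact: Hx|exact: Hy].
Qed.

Lemma subgroup1 H : is_subgroup H -> H 1.
Proof. by case. Qed.

Lemma subgroupV H x : is_subgroup H -> H x -> H x^-1.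
Proof. by move=> [H1 Hd] Hx; rewrite -[x^-1]mul1g; exact: Hd. Qed.

Lemma subgroupM H x y : is_subgroup H -> H x -> H y -> H (x * y).
Proof. by move=> HH Hx /(subgroupV HH) Hy; rewrite -[y]invgK; apply HH. Qed.

Lemma gen_by1 Y : gen_by Y 1.
Proof. exact: (subgroup1 (gen_by_subgroup Y)). Qed.

Lemma gen_byV Y x : gen_by Y x -> gen_by Y x^-1.
Proof. exact: (subgroupV (gen_by_subgroup Y)). Qed.

Lemma gen_byM Y x y : gen_by Y x -> gen_by Y y -> gen_by Y (x * y).
Proof. exact: (subgroupM (gen_by_subgroup Y)). Qed.

Lemma gen_byJ Y x y : gen_by Y x -> gen_by Y y -> gen_by Y (x^-1 * y * x).
Proof. by move=> Yx Yy; apply: gen_byM => //; apply: gen_byM => //; exact: gen_byV. Qed.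

Lemma gen_byJV Y x y : gen_by Y x -> gen_by Y y -> gen_by Y (x * y * x^-1).
Proof. by move=> Yx Yy; apply: gen_byM; [exact: gen_byM|exact: gen_byV]. Qed.

Lemma gen_by_le Y Z : Y `<=` Z -> gen_by Y `<=` gen_by Z.
Proof.
move=> YZ; apply: gen_by_min; first exact: gen_by_subgroup.
by move=> y /YZ; exact: gen_by_sub.
Qed.

Lemma subgroup_commute x : is_subgroup [set g | g * x = x * g].
Proof.
split=> [|g h /= gx hx]; first by rewrite /= mul1g mulg1.
have hVx : h^-1 * x = x * h^-1 by apply: (mulgI h); rewrite mulVKg mulgA hx mulgK.
by rewrite -mulgA hVx !mulgA gx.
Qed.

Lemma gen_by_commute Y x g :
  (forall y, Y y -> y * x = x * y) -> gen_by Y g -> g * x = x * g.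
Proof. by move=> Yx; exact: (gen_by_min (subgroup_commute x) Yx). Qed.

Lemma conj_by_gen_by g Y : conj_by g (gen_by Y) = gen_by (conj_by g Y).
Proof.
apply/seteqP; split=> [_ [h Yh <-]|].
  suff /gen_by_min : is_subgroup [set h | gen_by (conj_by g Y) (g * h * g^-1)].
    by move=> HY; apply: (HY Y _ h Yh) => y Yy; apply: gen_by_sub; exists y.
  split=> [|x y /= Hx Hy]; first by rewrite /= mulg1 mulgV; exact: gen_by1.
  have -> : g * (x / y) * g^-1 = (g * x * g^-1) / (g * y * g^-1).
    by rewrite !gnorm.
  by apply: gen_byM => //; exact: gen_byV.
apply: gen_by_min => [|_ [y Yy <-]]; last first.
  by exists y => //; exact: gen_by_sub.
split=> [|_ _ [x Yx <-] [y Yy <-]].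
  by exists 1; rewrite ?mulg1 ?mulgV //; exact: gen_by1.
exists (x / y); first by apply: gen_byM => //; exact: gen_byV.
by rewrite !gnorm.
Qed.

Lemma conj_byM g h H : conj_by (g * h) H = conj_by g (conj_by h H).
Proof.
apply/seteqP; split=> [_ [x Hx <-]|_ [_ [x Hx <-] <-]].
  by exists (h * x * h^-1); [exists x|rewrite !gnorm].
by exists x => //; rewrite !gnorm.
Qed.

Lemma conj_by1 H : conj_by 1 H = H.
Proof.
apply/seteqP; split=> [_ [x Hx <-]|x Hx]; first by rewrite !gsimp.
by exists x => //; rewrite !gsimp.
Qed.

Lemma conj_by_id g Y : gen_by Y g -> conj_by g (gen_by Y) = gen_by Y.
Proof.
move=> Yg; apply/seteqP; split=> [_ [x Yx <-]|x Yx]; first exact: gen_byJV.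
by exists (g^-1 * x * g); [exact: gen_byJ|rewrite !gnorm].
Qed.

Lemma word_in0 U g : word_in U g 0 <-> g = 1.
Proof.
split=> [[s [_ ->]]|->]; first by rewrite (tuple0 s) big_nil.
by exists [tuple]; split=> //; rewrite big_nil.
Qed.

Lemma word_in_cons U g n :
  word_in U g n.+1 <-> exists p h, [/\ U p, word_in U h n & g = p * h].
Proof.
split=> [[s [Us ->]]|[p [h [Up [s [Us ->]] ->]]]].
  exists (thead s), (\prod_(y <- behead s) y); split.
  - by apply: Us; rewrite (tuple_eta s) mem_head.
  - exists [tuple of behead s]; split=> // y ys; apply: Us.
    by rewrite (tuple_eta s) inE ys orbT.
  - by rewrite {1}(tuple_eta s) big_cons.
exists [tuple of p :: s]; split=> [y|]; last by rewrite big_cons.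
by rewrite inE => /orP[/eqP->|/Us].
Qed.

Lemma word_in_cat U g h m n : word_in U g m -> word_in U h n -> word_in U (g * h) (m + n).
Proof.
elim: m g => [|m IHm] g; first by move=> /word_in0->; rewrite mul1g.
move=> /word_in_cons[p [g' [Up Ug' ->]]] Uh; rewrite addSn.
by apply/word_in_cons; exists p, (g' * h); rewrite mulgA; split=> //; exact: IHm.
Qed.

Lemma word_in1 U p : U p -> word_in U p 1.
Proof.
by move=> Up; apply/word_in_cons; exists p, 1; rewrite mulg1; split=> //; apply/word_in0.
Qed.

Lemma word_in_inv U g n : (forall p, U p -> U p^-1) -> word_in U g n -> word_in U g^-1 n.
Proof.
move=> UV; elim: n g => [|n IHn] g; first by move=> /word_in0->; apply/word_in0; rewrite invg1.
move=> /word_in_cons[p [h [Up Uh ->]]]; rewrite invgM -addn1.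
by apply: word_in_cat; [exact: IHn|exact/word_in1/UV].
Qed.

Lemma word_in_sub U U' g n : U `<=` U' -> word_in U g n -> word_in U' g n.
Proof. by move=> UU' [s [Us gE]]; exists s; split=> // y /Us/UU'. Qed.

Lemma word_lengthP U g n : word_in U g n ->
  word_in U g (word_length U g) /\ (word_length U g <= n)%N.
Proof.
rewrite /word_length => Ug; case: pselect => [ex|[]]; last by exists n; apply/asboolP.
case: ex_minnP => m /asboolP Um mmin; split=> //.
by apply: mmin; apply/asboolP.
Qed.

Lemma finite_word_in U n : finite_set U -> finite_set [set g | word_in U g n].
Proof.
move=> fU; elim: n => [|n IHn].
  apply: sub_finite_set (finite_set1 (1 : D)) => g /= /word_in0 ->//.
apply: sub_finite_set (finite_image2 (fun p h => p * h) fU IHn) => g /=.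
by move=> /word_in_cons[p [h [Up Uh ->]]]; exists p => //; exists h.
Qed.

End GroupGeneralities.

Lemma finite_image_factor (T A B : choiceType) (H : set T) (p : T -> A) (q : T -> B) :
  (forall x y, H x -> H y -> p x = p y -> q x = q y) ->
  finite_set (p @` H) -> finite_set (q @` H).
Proof.
move=> pq fp; have [->|/set0P[x0 _]] := eqVneq H set0; first by rewrite image_set0.
pose r a := xget (q x0) [set b | exists2 x, H x & p x = a /\ q x = b].
apply: sub_finite_set (finite_image r fp) => _ [x Hx <-].
exists (p x); first by exists x.
rewrite /r; case: xgetP => [b -> [y Hy [/(pq _ _ Hy Hx) -> ->]]//|].
by move=> /(_ (q x))/=; case; exists x.
Qed.

(** * Actions of presented groups *)

Section Presentations.
Variables (V : choiceType) (R : seq (V * bool) -> seq (V * bool) -> Prop).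
Local Notation word := (seq (V * bool)).

(** The universal property of a presentation, for actions. The cocycle, the permutation action for
    edges labelled oo and the numbers game all descend from words to the group by it. *)
Lemma pres_eq_foldr (T : Type) (f : V * bool -> T -> T) :
    (forall v b a, f (v, b) (f (v, ~~ b) a) = a) ->
    (forall s t a, R s t -> foldr f a s = foldr f a t) ->
  forall s t a, pres_eq R s t -> foldr f a s = foldr f a t.
Proof.
move=> fK fR s t a st; elim: st a => {s t} //=.
- by move=> s t u _ st _ tu a; rewrite st.
- by move=> s s' t t' _ ss' _ tt' a; rewrite !foldr_cat tt' ss'.
- by move=> s t Rst a; exact: fR.
Qed.

Lemma presC_cat s t : presC R (s ++ t) = presC R s * presC R t.
Proof.
by apply/presCP; apply: PresCat; apply: PresSym; exact: pres_eq_repr.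
Qed.

End Presentations.

(** * The reflection cocycle *)

(* Reflections carry the label [f v], so that coefficients can be taken modulo
   the order of the generator v. *)
Definition coef (o : option nat) : nzRingType :=
  if o is Some n then 'Z_n : nzRingType else int : nzRingType.

Section Dyer.
Variables (D : groupType) (X : set D) (S : dyer_system X).
Local Notation G := (ds_graph S).
Local Notation vert := (ds_vert (S := S)).
Local Notation word := (seq (G * bool)).
Implicit Types (g h t : D) (u v : G) (o : option nat) (s : word).

Definition ev s : D := ds_iso S (presC (@dyer_rel G) s).

Definition letter (l : G * bool) : D := if l.2 then vert l.1 else (vert l.1)^-1.

Lemma ev_cat s s' : ev (s ++ s') = ev s * ev s'.
Proof. by rewrite /ev presC_cat gmulfM. Qed.

Lemma ev_nil : ev [::] = 1.
Proof. by apply: (mulgI (ev [::])); rewrite -ev_cat mulg1. Qed.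

Lemma ev_pres_eq s s' : ev s = ev s' <-> pres_eq (@dyer_rel G) s s'.
Proof.
split=> [/(bij_inj (ds_isoP S))/presCP//|ss']; congr (ds_iso S _).
exact/presCP.
Qed.

Lemma ev_rel s s' : dyer_rel s s' -> ev s = ev s'.
Proof. by move=> ss'; apply/ev_pres_eq/PresRel. Qed.

Lemma ev_letter l : ev [:: l] = letter l.
Proof.
case: l => v [] //; apply: (mulgI (vert v)); rewrite mulgV /=.
rewrite -[vert v]/(ev [:: (v, true)]) -ev_cat -ev_nil.
exact/ev_pres_eq/PresCancel.
Qed.

Lemma ev_cons l s : ev (l :: s) = letter l * ev s.
Proof. by rewrite -cat1s ev_cat ev_letter. Qed.

Lemma ev_surj g : exists s, ev s = g.
Proof.
have [f fK Kf] := ds_isoP S.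
by exists (repr (f g)); rewrite /ev pres_reprK Kf.
Qed.

Lemma vert_inj : injective vert.
Proof. by move=> u v; case: (ds_vertP S) => _ inj _; apply: inj; rewrite inE. Qed.

Lemma vertX v : X (vert v).
Proof. by case: (ds_vertP S) => sub _ _; exact: sub. Qed.

Lemma vert_surj x : X x -> exists v, x = vert v.
Proof. by case: (ds_vertP S) => _ _ surj /surj[v _ <-]; exists v. Qed.

Lemma dyer_commute u v : u != v -> ~~ dg_edge u v -> vert u * vert v = vert v * vert u.
Proof.
move=> uv /negbTE Nuv; have : ev (alt 2 u v) = ev (alt 2 v u).
  by apply/ev_rel/DyerBraid; rewrite // /dg_label Nuv.
by rewrite /= !ev_cons ev_nil /letter /= !mulg1.
Qed.

Lemma vert_expg v n : dg_f v = Some n -> vert v ^+ n = 1.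
Proof.
move=> /DyerPow/ev_rel; rewrite ev_nil => <-.
by elim: n => [|n IHn] /=; rewrite ?ev_nil // expgS IHn ev_cons.
Qed.

Lemma finite_label_order u v n : dg_edge u v -> dg_m u v = Some n ->
  dg_f u = Some 2 /\ dg_f v = Some 2.
Proof.
have order2 (w w' : G) : dg_edge w w' -> dg_m w w' = Some n -> dg_f w' = Some 2.
  move=> e m; have := dg_f_m e; have := dg_f_ge2 w'; rewrite m.
  by case: (dg_f w') => [[|[|[|k]]]|] //= _ /(_ isT).
move=> uv m; split; last exact: order2 m.
by apply: (order2 v u); rewrite ?(dg_edge_sym v u) // -dg_m_sym.
Qed.

Lemma vert_mulgg v : dg_f v = Some 2 -> vert v * vert v = 1.
Proof. by move=> fv; rewrite -expg2 (vert_expg fv). Qed.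

Lemma vert_invg v : dg_f v = Some 2 -> (vert v)^-1 = vert v.
Proof. by move=> fv; apply/mulg1_eq/vert_mulgg. Qed.

Lemma ev_alt n u v :
  ev (alt n u v) = (vert u * vert v) ^+ n./2 * vert u ^+ odd n.
Proof.
suff H m : ev (alt m.*2 u v) = (vert u * vert v) ^+ m /\
    ev (alt m.*2.+1 u v) = (vert u * vert v) ^+ m * vert u.
  rewrite -{1}(odd_double_half n); case: (odd n) (H n./2) => -[H1 H2].
    by rewrite add1n H2 expg1.
  by rewrite add0n H1 expg0 mulg1.
elim: m => [|m [IHm IHm']] /=.
  by rewrite ev_cons ev_nil mulg1 mul1g.
split; first by rewrite 2!ev_cons IHm expgS mulgA.
by move: IHm'; rewrite /= 3!ev_cons expgS -mulgA => <-; rewrite ev_cons !mulgA.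
Qed.

(** As u and v are involutions, both sides are the alternating word v u ... v with 2i + 1
    letters. *)
Lemma dihedral_reflection u v i : dg_f u = Some 2 -> dg_f v = Some 2 ->
  ((vert u * vert v) ^+ i.+1)^-1 * vert u = (vert v * vert u) ^+ i * vert v.
Proof.
move=> fu fv; rewrite -expVgn invgM !vert_invg // expgSr -mulgA.
by rewrite -(mulgA (vert v)) vert_mulgg // mulg1.
Qed.

Lemma dihedral_relation n u v : dg_f u = Some 2 -> dg_f v = Some 2 ->
  ev (alt n u v) = ev (alt n v u) -> (vert u * vert v) ^+ n = 1.
Proof.
move=> fu fv; rewrite !ev_alt; case: (boolP (odd n)) => on; last first.
  rewrite !expg0 !mulg1 -[vert v * vert u]invgK invgM !vert_invg // expVgn => E.
  have nE : n = (n./2 + n./2)%N.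
    by rewrite addnn -[LHS]odd_double_half (negbTE on).
  by rewrite nE expgnDr {1}E mulVg.
rewrite !expg1 -(dihedral_reflection n./2 fu fv) => /mulIg E.
have nE : n = (n./2.+1 + n./2)%N.
  by rewrite addSn addnn -[LHS]odd_double_half on.
by rewrite nE expgnDr E mulgV.
Qed.

Section Cocycle.
Variable o : option nat.

(** Each label [o] has a cocycle of its own, which counts only the generators v with [dg_f v = o];
    so its values all lie in the one ring [coef o]. *)
Definition delta v t : coef o := (if (t == vert v) && (o == dg_f v) then 1 else 0)%R.

(** Letters act on functions by affine maps. The contribution of v^-1 is -[v], since conjugation by
    v fixes v. *)
Definition cocycle_letter (l : G * bool) (F : D -> coef o) (t : D) : coef o :=
  ((if l.2 then delta l.1 t else - delta l.1 t) + F ((letter l)^-1 * t * letter l)%g)%R.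

Definition word_cocycle (s : word) : D -> coef o :=
  foldr cocycle_letter (fun=> 0%R) s.

Lemma conj_eq_vert v t : ((vert v)^-1 * t * vert v == vert v) = (t == vert v).
Proof.
apply/eqP/eqP => [/(congr1 (fun z => vert v * z * (vert v)^-1))|->].
  by rewrite !gnorm.
by rewrite !gnorm.
Qed.

Lemma conjV_eq_vert v t : (vert v * t * (vert v)^-1 == vert v) = (t == vert v).
Proof.
apply/eqP/eqP => [/(congr1 (fun z => (vert v)^-1 * z * vert v))|->].
  by rewrite !gnorm.
by rewrite !gnorm.
Qed.

Lemma delta_conj v t : delta v ((vert v)^-1 * t * vert v) = delta v t.
Proof. by rewrite /delta conj_eq_vert. Qed.

Lemma delta_conjV v t : delta v (vert v * t * (vert v)^-1) = delta v t.
Proof. by rewrite /delta conjV_eq_vert. Qed.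

Lemma foldr_cocycle F s t :
  foldr cocycle_letter F s t = (word_cocycle s t + F ((ev s)^-1 * t * ev s)%g)%R.
Proof.
elim: s t => [|l s IHs] t /=; first by rewrite ev_nil !gnorm add0r.
rewrite /word_cocycle /= /cocycle_letter IHs -addrA; congr (_ + (_ + F _))%R.
by rewrite ev_cons !gnorm.
Qed.

Lemma word_cocycle_cat s s' t :
  word_cocycle (s ++ s') t =
  (word_cocycle s t + word_cocycle s' ((ev s)^-1 * t * ev s)%g)%R.
Proof. by rewrite {1}/word_cocycle foldr_cat foldr_cocycle. Qed.

Lemma cocycle_letterK v b F :
  cocycle_letter (v, b) (cocycle_letter (v, ~~ b) F) = F.
Proof.
apply: functional_extensionality_dep => t; rewrite /cocycle_letter /letter /=.
case: b => /=; rewrite ?invgK ?delta_conj ?delta_conjV addrA ?addrN ?addNr add0r.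
  by congr F; rewrite !gnorm.
by congr F; rewrite !gnorm.
Qed.

Lemma word_cocycle_pow v n t :
  word_cocycle (nseq n (v, true)) t = (delta v t *+ n)%R.
Proof.
elim: n t => [|n IHn] t //=; rewrite /word_cocycle /= /cocycle_letter /=.
by rewrite -/(word_cocycle _) IHn /letter /= delta_conj mulrS.
Qed.

(** Conjugating letter number i, counted from 0, by the prefix before it gives the palindrome (uv)^i
    u with 2i + 1 letters. *)
Lemma word_cocycle_alt u v n t : dg_f u = Some 2 -> dg_f v = Some 2 ->
  word_cocycle (alt n u v) t =
  (\sum_(i < n) (if (t == (vert u * vert v) ^+ i * vert u)%g
                   && (o == Some 2) then 1 else 0))%R.
Proof.
elim: n u v t => [|n IHn] u v t fu fv /=; first by rewrite big_ord0.
rewrite big_ord_recl expg0 mul1g /word_cocycle /= /cocycle_letter /=.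
rewrite -/(word_cocycle _) IHn // /delta fu; congr (_ + _)%R.
apply: eq_bigr => i _; congr (if _ && _ then _ else _).
have uu : vert u * vert u = 1 by rewrite -expg2 (vert_expg fu).
have uV : (vert u)^-1 = vert u by exact: mulg1_eq.
have uvX j : vert u * (vert v * vert u) ^+ j = (vert u * vert v) ^+ j * vert u.
  elim: j => [|j IHj]; first by rewrite !expg0 mulg1 mul1g.
  by rewrite expgSr mulgA IHj expgSr !mulgA.
rewrite /letter /= /bump /= add1n; apply/eqP/eqP => [|->].
  move=> /(congr1 (fun z => vert u * z * (vert u)^-1)).
  by rewrite !gnorm => ->; rewrite uV uvX expgSr !mulgA.
apply: (mulgI (vert u)).
by rewrite -!mulgA mulVKg uu mulg1 (mulgA (vert u)) uvX -mulgA -expgSr.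
Qed.

(** A power relation contributes n[v], which is 0 modulo n; a commutation contributes [u] + [v] on
    both sides; a braid relation lists the same n reflections in opposite orders, because (uv)^n =
    1. *)
Lemma word_cocycle_rel s s' t : dyer_rel s s' -> word_cocycle s t = word_cocycle s' t.
Proof.
case=> [v n fv|u v n uv].
  rewrite word_cocycle_pow /delta fv; case: ifP => [/andP[_ /eqP oE]|_]; last by rewrite mul0rn.
  have := dg_f_ge2 v; rewrite fv => n1.
  suff mulrn0 o' (c : coef o') : o' = Some n -> (c *+ n = 0)%R by exact: mulrn0.
  move=> o'E; subst o'; rewrite -mulr_natr (_ : n%:R%R = 0%R) ?mulr0 //.
  exact: pchar_Zp.
move=> fuv; have [e|Nuv] := boolP (dg_edge u v); last first.
  move: fuv; rewrite /dg_label (negbTE Nuv) => -[<-].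
  rewrite /word_cocycle /= /cocycle_letter /= !addr0 addrC.
  have uvC := dyer_commute uv Nuv.
  have deltaC w w' : vert w * vert w' = vert w' * vert w ->
      delta w' ((vert w)^-1 * t * vert w) = delta w' t.
    move=> ww'; congr (if _ && _ then _ else _)%R.
    apply/eqP/eqP => [/(congr1 (fun z => vert w * z * (vert w)^-1))|->].
      by rewrite !gnorm => ->; rewrite ww' mulgK.
    by rewrite -mulgA -ww' mulKg.
  by congr (_ + _)%R; rewrite deltaC.
have [fu fv] : dg_f u = Some 2 /\ dg_f v = Some 2.
  by apply: (@finite_label_order _ _ n); rewrite // -fuv /dg_label e.
have uvn := dihedral_relation fu fv (ev_rel (DyerBraid uv fuv)).
rewrite !word_cocycle_alt // (reindex_inj rev_ord_inj) /=; apply: eq_bigr => i _.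
rewrite -(dihedral_reflection i fu fv).
congr (if (t == _ * _) && _ then _ else _).
apply: (mulIg ((vert u * vert v) ^+ i.+1)); rewrite -expgnDr.
by rewrite subnK // mulVg uvn.
Qed.

End Cocycle.
End Dyer.

(** * The cocycle of a group element *)

Section Reflections.
Variables (D : groupType) (X : set D) (S : dyer_system X).
Local Notation G := (ds_graph S).
Local Notation vert := (ds_vert (S := S)).
Local Notation word_cocycle := (@word_cocycle D X S).
Implicit Types (g h p q t : D) (u v : G) (o : option nat) (A B : {set G}).

Definition word_of g : seq (G * bool) := sval (cid (ev_surj S g)).

Lemma word_ofK g : ev (word_of g) = g.
Proof. exact: (svalP (cid (ev_surj S g))). Qed.

Definition cocycle o g t : coef o := word_cocycle o (word_of g) t.

(** The value does not depend on the chosen word: the two sides of a relation agree in [ev] and in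
    [word_cocycle], and these determine the affine action. *)
Lemma cocycle_ev o s t : cocycle o (ev s) t = word_cocycle o s t.
Proof.
rewrite /cocycle /word_cocycle.
have /ev_pres_eq : ev (word_of (ev s)) = ev s by rewrite word_ofK.
move=> /(pres_eq_foldr (f := @cocycle_letter _ _ S o)) -> //; first exact: cocycle_letterK.
move=> s1 s2 F rs; apply: functional_extensionality_dep => z.
by rewrite !foldr_cocycle (ev_rel rs) (word_cocycle_rel _ _ rs).
Qed.

Lemma cocycleM o g h t :
  cocycle o (g * h) t = (cocycle o g t + cocycle o h (g^-1 * t * g)%g)%R.
Proof.
rewrite -[g * h](_ : ev (word_of g ++ word_of h) = _); last by rewrite ev_cat !word_ofK.
by rewrite cocycle_ev word_cocycle_cat word_ofK.
Qed.

Lemma cocycle1 o t : cocycle o 1 t = 0%R.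
Proof. by rewrite -(ev_nil S) cocycle_ev. Qed.

Lemma cocycleV o g t : cocycle o g^-1 t = (- cocycle o g (g * t * g^-1)%g)%R.
Proof.
have := cocycleM o g^-1 g t.
by rewrite mulVg cocycle1 invgK => /esym/eqP; rewrite addr_eq0 => /eqP.
Qed.

Lemma cocycle_vert o v t : cocycle o (vert v) t = delta o v t.
Proof.
rewrite -[vert v](ev_letter (v, true)) cocycle_ev.
by rewrite /word_cocycle /= /cocycle_letter /= addr0.
Qed.

Lemma coef1_neq0 o : (1 != 0 :> coef o)%R.
Proof. exact: oner_neq0. Qed.

Lemma delta_neq0 o v t : (delta o v t != 0%R) = (t == vert v) && (o == dg_f v).
Proof. by rewrite /delta; case: ifP; rewrite ?coef1_neq0 ?eqxx. Qed.

Definition parab A : set D := gen_by [set vert v | v in [set` A]].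

Lemma parab_vert A v : v \in A -> parab A (vert v).
Proof. by move=> Av; apply: gen_by_sub; exists v. Qed.

Lemma parabS A B : A \subset B -> parab A `<=` parab B.
Proof.
by move=> /fintype.subsetP AB; apply: gen_by_le => _ [v Av <-]; exists v => //; exact: AB.
Qed.

Lemma parab_min A H : is_subgroup H -> (forall v, v \in A -> H (vert v)) -> parab A `<=` H.
Proof. by move=> sH AH; apply: gen_by_min => // _ [v Av <-]; exact: AH. Qed.

Lemma parab1_sub A v p : v \in A -> parab [set v]%SET p -> parab A p.
Proof. by move=> Av; apply: parabS; rewrite finset.sub1set. Qed.

Lemma parabT g : parab [set: G]%SET g.
Proof.
have : [set: D] g by []; rewrite -(ds_genP S); apply: gen_by_le.
by move=> _ /(vert_surj S)[v ->]; exists v => //=; rewrite inE.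
Qed.

(** By the cocycle identity the reflections of x y^-1 are among those of x and the conjugates by x
    y^-1 of those of y, so the property passes to quotients. *)
Lemma cocycle_support A o g t : parab A g -> cocycle o g t != 0%R -> parab A t.
Proof.
suff H : parab A `<=` [set g | parab A g /\ forall t, cocycle o g t != 0%R -> parab A t].
  by move=> /H[_]; exact.
apply: parab_min => [|v Av].
  split=> [|x y [Ax Hx] [Ay Hy]]; first by split=> [|z]; [exact: gen_by1|rewrite cocycle1 eqxx].
  split=> [|z]; first by apply: gen_byM => //; exact: gen_byV.
  rewrite cocycleM cocycleV; have [x0|/Hx//] := eqVneq (cocycle o x z) 0%R.
  rewrite x0 add0r oppr_eq0 => /Hy.
  have /(gen_byJ Ay) H : parab A x^-1 by exact: gen_byV.
  move=> H1; suff -> : z = (x * y^-1) * (y * (x^-1 * z * x) * y^-1) * (x * y^-1)^-1.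
    by apply: gen_byJV => //; apply: gen_byM => //; exact: gen_byV.
  by rewrite !gnorm.
split=> [|z]; first exact: parab_vert.
by rewrite cocycle_vert delta_neq0 => /andP[/eqP-> _]; exact: parab_vert.
Qed.

Lemma finite_cocycle_support o g : finite_set [set t | cocycle o g t != 0%R].
Proof.
suff H : parab [set: G]%SET `<=` [set g | finite_set [set t | cocycle o g t != 0%R]].
  exact: (H g (parabT g)).
apply: parab_min => [|v _] /=; last first.
  apply: sub_finite_set (finite_set1 (vert v)) => t /=.
  by rewrite cocycle_vert delta_neq0 => /andP[/eqP->].
split=> [|x y /= fx fy] /=.
  by apply: sub_finite_set (finite_set0 D) => t /=; rewrite cocycle1 eqxx.
have fy' := finite_image (fun t => x * y^-1 * t * y * x^-1) fy.
have fxy : finite_set ([set t | cocycle o x t != 0%R] `|`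
   [set x * y^-1 * t * y * x^-1 | t in [set t | cocycle o y t != 0%R]]).
  by rewrite finite_setU.
apply: sub_finite_set fxy => t /=.
rewrite cocycleM cocycleV; have [->|] := eqVneq (cocycle o x t) 0%R; last by left.
rewrite add0r oppr_eq0 => yt; right; eexists; first exact: yt.
by rewrite !gnorm.
Qed.

Lemma cyclic_form v p : parab [set v]%SET p ->
  exists m n, p = vert v ^+ m * (vert v ^+ n)^-1.
Proof.
move: p; apply: (@parab_min _ [set p | exists m n, p = vert v ^+ m * (vert v ^+ n)^-1]).
  split=> [|_ _ [m [n ->]] [m' [n' ->]]] /=; first by exists 0%N, 0%N; rewrite mulgV.
  exists (m + n')%N, (m' + n)%N; rewrite !invgM invgK !expgnDr !invgM -!mulgA.
  congr (_ * _); rewrite !mulgA; congr (_ * _).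
  have vC i j : vert v ^+ i * vert v ^+ j = vert v ^+ j * vert v ^+ i.
    by rewrite -!expgnDr addnC.
  by apply: (mulgI (vert v ^+ n)); rewrite mulgA mulgV mul1g mulgA vC mulgK.
by move=> u; rewrite inE => /eqP->; exists 1%N, 0%N; rewrite expg0 expg1 divg1.
Qed.

Lemma cocycle_expg o v n t : cocycle o (vert v ^+ n) t = (delta o v t *+ n)%R.
Proof.
elim: n => [|n IHn]; first by rewrite expg0 cocycle1.
rewrite expgSr cocycleM IHn cocycle_vert mulrSr; congr (_ + _)%R.
congr (if _ && _ then _ else _)%R.
apply/eqP/eqP => [/(congr1 (fun z => vert v ^+ n * z * (vert v ^+ n)^-1))|->].
  by rewrite !gnorm => ->; rewrite -expgSr expgS mulgK.
by rewrite -mulgA -expgS expgSr mulKg.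
Qed.

Lemma cyclic_commute v p : parab [set v]%SET p -> p * vert v = vert v * p.
Proof.
by apply: gen_by_commute => _ [u /= + <-]; rewrite inE => /eqP->.
Qed.

Lemma cocycle_cyclic o v p t : parab [set v]%SET p -> cocycle o p t != 0%R ->
  t = vert v /\ o = dg_f v.
Proof.
suff H : parab [set v]%SET `<=` [set p | parab [set v]%SET p /\
    forall t, cocycle o p t != 0%R -> t = vert v /\ o = dg_f v].
  by move=> /H[_]; exact.
apply: parab_min => [|u].
  split=> [|x y [vx Hx] [vy Hy]].
    by split=> [|z]; [exact: gen_by1|rewrite cocycle1 eqxx].
  have vxy : parab [set v]%SET (x / y) by apply: gen_byM => //; exact: gen_byV.
  split=> // z; rewrite cocycleM cocycleV.
  have [->|/Hx//] := eqVneq (cocycle o x z) 0%R.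
  rewrite add0r oppr_eq0 => /Hy[zE ->]; split=> //.
  apply: (mulIg (x / y)); rewrite -(cyclic_commute vxy) -zE.
  by rewrite !gnorm.
rewrite inE => /eqP->; split=> [|z]; first by apply: parab_vert; rewrite inE.
by rewrite cocycle_vert delta_neq0 => /andP[/eqP-> /eqP->].
Qed.

Lemma coef_natrB f m n : ltn_inf 1 f -> (m%:R == n%:R :> coef f)%R ->
  if f is Some k then m = n %[mod k] else m = n.
Proof.
case: f => [k|_] /=.
  move=> k1 /eqP E; rewrite -(val_Zp_nat k1) -(val_Zp_nat k1); congr (val _).
  exact: E.
suff H : (m%:R == n%:R :> int)%R -> m = n by exact: H.
by rewrite !natz => /eqP[].
Qed.

Lemma vert_expg_mod v k m n : dg_f v = Some k -> m = n %[mod k] ->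
  vert v ^+ m = vert v ^+ n.
Proof.
move=> fv mn; rewrite (divn_eq m k) (divn_eq n k) mn !expgnDr.
by rewrite ![(_ * k)%N]mulnC !expgnA (vert_expg fv) !expg1n.
Qed.

(** For p = v^m v^-n the coefficient at v is m - n, taken modulo n' if [dg_f v = Some n'], and this
    determines p. *)
Lemma cyclic_faithful v p : parab [set v]%SET p ->
  cocycle (dg_f v) p (vert v) = 0%R -> p = 1.
Proof.
move=> /cyclic_form[m [n ->]]; rewrite cocycleM cocycleV !cocycle_expg.
have vX k : vert v ^+ k * vert v = vert v * vert v ^+ k by rewrite -expgSr -expgS.
have -> : vert v ^+ n * (vert v ^- m * vert v * vert v ^+ m) * vert v ^- n = vert v.
  by rewrite -(mulgA (_ ^- m)) -vX mulKg vX mulgK.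
rewrite /delta !eqxx => /eqP; rewrite subr_eq0 => /(coef_natrB (dg_f_ge2 v)).
case fv : (dg_f v) => [k|] mn; last by rewrite mn mulgV.
by rewrite (vert_expg_mod fv mn) mulgV.
Qed.

(** The coefficient of v^n at v is n, so v^n = 1 forces n to vanish in [coef (dg_f v)]. *)
Lemma elt_order_vert v : elt_order (vert v) = dg_f v.
Proof.
have ord n : vert v ^+ n = 1 -> (n%:R == 0 :> coef (dg_f v))%R.
  move=> vn; have := cocycle_expg (dg_f v) v n (vert v).
  by rewrite vn cocycle1 /delta !eqxx => <-.
rewrite /elt_order; case: pselect => [ex|Nex].
  case: ex_minnP => n /andP[n0 /eqP vn] nmin.
  move: (ord _ vn) => /(coef_natrB (n := 0) (dg_f_ge2 v)).
  have := dg_f_ge2 v; case fv: (dg_f v) => [k|] /= k1 nk; last by rewrite nk in n0.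
  congr Some; apply/eqP; rewrite eqn_leq nmin; last first.
    by rewrite (vert_expg fv) eqxx (ltnW k1).
  by rewrite dvdn_leq // /dvdn nk mod0n.
case fv: (dg_f v) => [k|] //; case: Nex; exists k.
by rewrite (vert_expg fv) eqxx; have := dg_f_ge2 v; rewrite fv => /ltnW ->.
Qed.

Lemma vert_neq1 v : vert v != 1.
Proof.
apply: contraNneq (coef1_neq0 (dg_f v)) => v1.
by rewrite -(cocycle1 _ (vert v)) -v1 cocycle_vert /delta v1 !eqxx.
Qed.

End Reflections.

(** * Length, descents and cosets *)

Section Length.
Variables (D : groupType) (X : set D) (S : dyer_system X).
Local Notation G := (ds_graph S).
Local Notation vert := (ds_vert (S := S)).
Local Notation cocycle := (cocycle S).
Local Notation parab := (parab (S := S)).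
Implicit Types (g h p q t : D) (u v : G) (o : option nat) (A B : {set G}).

Definition syllable A p := exists2 v, v \in A & parab [set v]%SET p.

(** Length in syllables: any power of a generator costs one letter. On D_A the value does not depend
    on A, by [rel_length_setT]. *)
Definition rel_length A g := word_length (syllable A) g.

(* g is the shortest element of D_B g *)
Definition reduced B g := forall o t, parab B t -> cocycle o g t = 0%R.

(** A left descent: by [rel_length_descent] this holds exactly when some power of v shortens g. *)
Definition descent g v := cocycle (dg_f v) g (vert v) != 0%R.

Lemma syllableV A p : syllable A p -> syllable A p^-1.
Proof. by case=> v Av vp; exists v => //; exact: gen_byV. Qed.

Lemma parab_word A g : parab A g -> exists n, word_in (syllable A) g n.
Proof.
apply: (parab_min (H := [set g | exists n, word_in (syllable A) g n])) => [|v Av].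
  split=> [|x y [m Ax] [n Ay]]; first by exists 0%N; apply/word_in0.
  exists (m + n)%N; apply: word_in_cat => //; apply: word_in_inv => //.
  exact: syllableV.
by exists 1%N; apply: word_in1; exists v => //; apply: parab_vert; rewrite inE.
Qed.

Lemma rel_lengthP A g : parab A g -> word_in (syllable A) g (rel_length A g).
Proof. by move=> /parab_word[n /word_lengthP[]]. Qed.

Lemma rel_length_le A g n : word_in (syllable A) g n -> (rel_length A g <= n)%N.
Proof. by move=> /word_lengthP[]. Qed.

Lemma rel_lengthM A g h : parab A g -> parab A h ->
  (rel_length A (g * h) <= rel_length A g + rel_length A h)%N.
Proof.
by move=> Ag Ah; apply/rel_length_le/word_in_cat; exact: rel_lengthP.
Qed.

Lemma rel_lengthV A g : parab A g -> rel_length A g^-1 = rel_length A g.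
Proof.
suff le h : parab A h -> (rel_length A h^-1 <= rel_length A h)%N.
  by move=> Ag; apply/eqP; rewrite eqn_leq le // -{1}[g]invgK le //; exact: gen_byV.
move=> Ah; apply/rel_length_le/word_in_inv; [exact: syllableV|exact: rel_lengthP].
Qed.

Lemma rel_length0 A g : parab A g -> rel_length A g = 0%N -> g = 1.
Proof. by move=> /rel_lengthP + l0; rewrite l0 => /word_in0. Qed.

Lemma rel_length1 A : rel_length A 1 = 0%N.
Proof. by apply/eqP; rewrite -leqn0; apply/rel_length_le/word_in0. Qed.

Lemma rel_length_syllable A p : syllable A p -> (rel_length A p <= 1)%N.
Proof. by move=> Ap; exact/rel_length_le/word_in1. Qed.

(* Deleting from a word for g a syllable whose reflection is t multiplies g on
   the left by a power of t. *)
Lemma exchange_word A o g t n : word_in (syllable A) g n -> cocycle o g t != 0%R ->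
  exists2 q, gen_by [set t] q & (0 < n)%N /\ word_in (syllable A) (q * g) n.-1.
Proof.
elim: n g t => [|n IHn] g t; first by move=> /word_in0->; rewrite cocycle1 eqxx.
move=> /word_in_cons[p [h [[v Av vp] Ah ->]]]; rewrite cocycleM.
have [p0|/(cocycle_cyclic vp)[-> _] _] := eqVneq (cocycle o p t) 0%R; last first.
  exists p^-1; last by rewrite mulKg.
  apply: gen_byV; move: p vp; apply: gen_by_le => _ [u /= + <-].
  by rewrite inE => /eqP->.
rewrite p0 add0r => /(IHn _ _ Ah)[q tq [n0 Aqh]].
exists (p * q * p^-1); last split=> //.
  have : conj_by p (gen_by [set p^-1 * t * p]) (p * q * p^-1) by exists q.
  rewrite conj_by_gen_by; apply: gen_by_le => _ [_ -> <-].
  by rewrite !gnorm.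
rewrite -(prednK n0) /=; apply/word_in_cons; exists p, (q * h); split=> //.
  by exists v.
by rewrite !gnorm.
Qed.

Lemma exchange A o g t : parab A g -> cocycle o g t != 0%R ->
  exists2 q, gen_by [set t] q & (rel_length A (q * g) < rel_length A g)%N.
Proof.
move=> Ag /(exchange_word (rel_lengthP Ag))[q tq [l0 /rel_length_le le]].
by exists q => //; rewrite (leq_ltn_trans le) // ltn_predL.
Qed.

Lemma reduced_min A B g : parab A g ->
  (forall q, parab B q -> (rel_length A g <= rel_length A (q * g))%N) -> reduced B g.
Proof.
move=> Ag gmin o t Bt; apply/eqP; apply: contraT => /(exchange Ag)[q tq].
rewrite ltnNge gmin //; apply: gen_by_min q tq; first exact: gen_by_subgroup.
by move=> _ ->.
Qed.

Lemma coset_reduced A B g : B \subset A -> parab A g ->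
  exists q, [/\ parab B q, reduced B (q * g) &
    forall q', parab B q' -> (rel_length A (q * g) <= rel_length A (q' * g))%N].
Proof.
move=> BA Ag; pose Q n := `[< exists2 q, parab B q & rel_length A (q * g) = n >].
have exQ : exists n, Q n.
  by exists (rel_length A g); apply/asboolP; exists 1; rewrite ?mul1g //; exact: gen_by1.
have [m /asboolP[q Bq <-] qmin] := ex_minnP exQ.
have qmin' q' : parab B q' -> (rel_length A (q * g) <= rel_length A (q' * g))%N.
  by move=> Bq'; apply: qmin; apply/asboolP; exists q'.
exists q; split=> //; apply: (@reduced_min A) => [|q' Bq'].
  by apply: gen_byM => //; exact: parabS Bq.
by rewrite mulgA; apply: qmin'; exact: gen_byM.
Qed.

Lemma descentMl g p v : parab [set v]%SET p ->
  cocycle (dg_f v) (p * g) (vert v) =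
  (cocycle (dg_f v) p (vert v) + cocycle (dg_f v) g (vert v))%R.
Proof. by move=> vp; rewrite cocycleM -mulgA -(cyclic_commute vp) mulKg. Qed.

(** Here q g is the shortest element in the coset of g under the powers of v. Another element p g of
    that length would be reduced as well; then p / q has coefficient 0 at v and is trivial. *)
Lemma rel_length_descent A v g : v \in A -> parab A g ->
  exists q, [/\ parab [set v]%SET q, ~~ descent (q * g) v, (q != 1) = descent g v &
    (rel_length A g = rel_length A (q * g) + (q != 1)%g)%N /\
    forall p, parab [set v]%SET p -> p != q ->
      rel_length A (p * g) = (rel_length A (q * g)).+1].
Proof.
move=> Av Ag; have vA : [set v]%SET \subset A by rewrite finset.sub1set.
have vv : parab [set v]%SET (vert v) by apply: parab_vert; rewrite inE.
have [q [vq qred qmin]] := coset_reduced vA Ag.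
have qg0 := qred (dg_f v) _ vv.
have main p : parab [set v]%SET p -> p != q ->
    rel_length A (p * g) = (rel_length A (q * g)).+1.
  move=> vp pq; have Aq := parabS vA vq; have Ap := parabS vA vp.
  have vpq : parab [set v]%SET (p / q) by apply: gen_byM => //; exact: gen_byV.
  have pg : p * g = (p / q) * (q * g) by rewrite !gnorm.
  apply/eqP; rewrite eqn_leq; apply/andP; split.
    rewrite pg (leq_trans (rel_lengthM _ _)) //.
    - exact: parabS vA _ vpq.
    - exact: gen_byM.
    - by rewrite -add1n leq_add2r; apply: rel_length_syllable; exists v.
  rewrite ltnNge; apply: contra pq => le; rewrite -divg_eq1; apply/eqP.
  apply: (cyclic_faithful vpq).
  suff : reduced [set v]%SET (p * g).
    by move=> /(_ (dg_f v) _ vv); rewrite pg descentMl // qg0 addr0.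
  apply: (@reduced_min A) => [|q' vq']; first exact: gen_byM.
  by rewrite (leq_trans le) // mulgA; apply: qmin; exact: gen_byM.
exists q; split=> //; first by rewrite /descent qg0 eqxx.
  apply/idP/idP => [|gv]; last first.
    by apply: contraNneq gv => q1; rewrite -[g]mul1g -q1 qg0.
  apply: contra_neq => g0; apply: (cyclic_faithful vq); move: qg0.
  by rewrite descentMl // g0 addr0.
split=> //; have [q1|q1] := eqVneq q 1; first by rewrite q1 mul1g addn0.
rewrite addn1.
have /main <- : parab [set v]%SET 1 by exact: gen_by1.
  by rewrite mul1g.
by rewrite eq_sym.
Qed.

Lemma rel_length_Ndescent A v g p : v \in A -> parab A g -> ~~ descent g v ->
  parab [set v]%SET p -> p != 1 -> rel_length A (p * g) = (rel_length A g).+1.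
Proof.
move=> Av Ag gv vp p1; have [q [_ _ qE [_ H]]] := rel_length_descent Av Ag.
move: (gv); rewrite -qE negbK => /eqP q1; rewrite q1 mul1g in H.
exact: H.
Qed.

Lemma descent_split A v g : v \in A -> parab A g -> descent g v ->
  exists p h, [/\ g = p * h, parab [set v]%SET p, p != 1, parab A h &
    ~~ descent h v /\ rel_length A g = (rel_length A h).+1].
Proof.
move=> Av Ag gv; have [q [vq hv qE [gE _]]] := rel_length_descent Av Ag.
exists q^-1, (q * g); split.
- by rewrite mulKg.
- exact: gen_byV.
- by rewrite invg_eq1 qE.
- by apply: gen_byM => //; exact: parab1_sub vq.
- by split=> //; rewrite gE qE gv addn1.
Qed.

(** The first syllable of a shortest word belongs to a descent; otherwise removing it would make the
    element longer. *)
Lemma exists_descent A g : parab A g -> g != 1 -> exists2 v, v \in A & descent g v.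
Proof.
move=> Ag g1; case l: (rel_length A g) => [|n].
  by move: g1; rewrite (rel_length0 Ag l) eqxx.
have := rel_lengthP Ag; rewrite l => /word_in_cons[p [h [[v Av vp] Ah gE]]].
exists v => //; apply: contraT => gv.
have Ap : parab A p by exact: parab1_sub vp.
have hE : h = p^-1 * g by rewrite gE mulKg.
have p1 : p^-1 != 1.
  apply: contraPneq l => p1; rewrite gE -[p]invgK p1 invg1 mul1g => hl.
  by have := rel_length_le Ah; rewrite hl ltnn.
have := rel_length_le Ah; rewrite hE (rel_length_Ndescent Av) //; last exact: gen_byV.
by rewrite l -ltnS => /ltnW; rewrite ltnn.
Qed.

(** Descents do not refer to the alphabet, so peeling them off computes both lengths alike. *)
Lemma rel_length_setT A g : parab A g -> rel_length A g = rel_length [set: G]%SET g.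
Proof.
have [n] := ubnP (rel_length A g); elim: n g => [|n IHn] g //; rewrite ltnS => ln Ag.
have [->|g1] := eqVneq g 1; first by rewrite !rel_length1.
have [v Av gv] := exists_descent Ag g1.
have [p [h [gE vp p1 Ah [hv lg]]]] := descent_split Av Ag gv.
have vT : v \in [set: G]%SET by rewrite inE.
rewrite lg gE (rel_length_Ndescent vT (parabT _) hv vp p1) IHn //.
by rewrite -lg.
Qed.

End Length.

(** * Shortest coset representatives and centralizers *)

Section Cosets.
Variables (D : groupType) (X : set D) (S : dyer_system X).
Local Notation G := (ds_graph S).
Local Notation vert := (ds_vert (S := S)).
Local Notation cocycle := (cocycle S).
Local Notation parab := (parab (S := S)).
Local Notation reduced := (reduced (S := S)).
Local Notation descent := (descent (S := S)).
Implicit Types (g h p q t : D) (u v : G) (o : option nat) (A B : {set G}).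

Definition len g := rel_length (S := S) [set: G]%SET g.

Lemma lenM g h : (len (g * h) <= len g + len h)%N.
Proof. by apply: rel_lengthM; exact: parabT. Qed.

Lemma lenV g : len g^-1 = len g.
Proof. by apply: rel_lengthV; exact: parabT. Qed.

Lemma len0 g : len g = 0%N -> g = 1.
Proof. by apply: rel_length0; exact: parabT. Qed.

Lemma len1 : len 1 = 0%N.
Proof. exact: rel_length1. Qed.

Lemma len_vert v : (len (vert v) <= 1)%N.
Proof.
by apply: rel_length_syllable; exists v; rewrite ?inE //; apply: parab_vert; rewrite inE.
Qed.

Lemma len_Ndescent v g p : ~~ descent g v -> parab [set v]%SET p -> p != 1 ->
  len (p * g) = (len g).+1.
Proof.
by move=> gv vp p1; apply: rel_length_Ndescent gv vp p1; [rewrite inE|exact: parabT].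
Qed.

Lemma descent_peel A v g : v \in A -> parab A g -> descent g v ->
  exists p h, [/\ g = p * h, parab [set v]%SET p, p != 1, parab A h &
    ~~ descent h v /\ len g = (len h).+1].
Proof.
move=> Av Ag gv; have [p [h [gE vp p1 Ah [hv lg]]]] := descent_split Av Ag gv.
by exists p, h; split=> //; split=> //; rewrite /len -!(rel_length_setT (A := A)).
Qed.

Lemma exchange_len o g t : cocycle o g t != 0%R ->
  exists2 q, gen_by [set t] q & (len (q * g) < len g)%N.
Proof. by apply: exchange; exact: parabT. Qed.

Lemma coset_min A g : exists q, [/\ parab A q, reduced A (q * g) &
  forall q', parab A q' -> (len (q * g) <= len (q' * g))%N].
Proof. by apply: coset_reduced; [exact: finset.subsetT|exact: parabT]. Qed.

(** Peel a descent v off g, leaving k. As N(h) vanishes at k^-1 v k, which lies in D_A, v is not a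
    descent of k h either. *)
Lemma reduced_lenM A g h : reduced A h -> parab A g -> len (g * h) = (len g + len h)%N.
Proof.
move=> hr; have [n] := ubnP (len g); elim: n g => [|n IHn] g //; rewrite ltnS => ln Ag.
have [->|g1] := eqVneq g 1; first by rewrite mul1g len1.
have [v Av gv] := exists_descent Ag g1.
have [p [k [gE vp p1 Ak [kv lg]]]] := descent_peel Av Ag gv.
have lk : (len k < n)%N by rewrite -lg.
rewrite lg addSn -(IHn k lk Ak) gE -mulgA.
apply: (@len_Ndescent v) => //; move: kv; rewrite /descent cocycleM negbK => /eqP->.
by rewrite add0r hr ?eqxx //; apply: gen_byJ => //; exact: parab_vert.
Qed.

Lemma parab_vertE A v : parab A (vert v) -> v \in A.
Proof.
move=> /exists_descent/(_ (vert_neq1 _))[u Au].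
by rewrite /descent cocycle_vert delta_neq0 => /andP[/eqP/vert_inj<-].
Qed.

Lemma vert_notin A v : v \notin A -> ~ parab A (vert v).
Proof. by move=> vA /parab_vertE; exact/negP. Qed.

Lemma parab_disjoint_cocycle A o g v : v \notin A -> parab A g -> cocycle o g (vert v) = 0%R.
Proof.
by move=> vA Ag; apply/eqP/negPn/negP => /(cocycle_support Ag)/(vert_notin vA).
Qed.

Lemma parab_len1 A g : parab A g -> g != 1 -> (len g <= 1)%N ->
  exists2 v, v \in A & parab [set v]%SET g.
Proof.
move=> Ag g1 lg; have [v Av gv] := exists_descent Ag g1; exists v => //.
have [p [k [gE vp _ _ [_ lk]]]] := descent_peel Av Ag gv.
by move: lg; rewrite lk ltnS leqn0 gE => /eqP/len0->; rewrite mulg1.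
Qed.

(** The nonzero coefficient of q k = k v at u can only come from the final letter v, whence k^-1 u k
    = v. This excludes that q is another power of u. *)
Lemma conj_syllable_vert k q u v : parab [set u]%SET q -> q != 1 -> ~~ descent k u ->
  q * k = k * vert v -> q = vert u.
Proof.
move=> uq q1 ku qk.
have := descentMl k uq; rewrite qk cocycleM.
move: ku; rewrite /descent negbK => /eqP ->; rewrite add0r addr0 cocycle_vert => H.
have : delta (dg_f u) v (k^-1 * vert u * k) != 0%R.
  by rewrite H; apply: contra_neq q1 => /(cyclic_faithful uq).
rewrite delta_neq0 => /andP[/eqP kuk _].
by apply: (mulIg k); rewrite qk -kuk !gnorm.
Qed.

(** In g v = v h with g and h in D_A, the coefficient 1 of the right side at v must come from the
    letter v on the left, so g^-1 v g = v. *)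
Lemma parab_conj_commute A g v : v \notin A -> parab A g ->
  parab A ((vert v)^-1 * g * vert v) -> g * vert v = vert v * g.
Proof.
move=> vA Ag; set h := (X in parab A X) => Ah.
have gvh : g * vert v = vert v * h by rewrite /h !gnorm.
have := cocycleM S (dg_f v) g (vert v) (vert v).
rewrite gvh cocycleM !cocycle_vert -mulgA mulKg !(parab_disjoint_cocycle _ vA) //.
rewrite add0r addr0 => H.
have : delta (dg_f v) v (g^-1 * vert v * g) != 0%R.
  by rewrite -H delta_neq0 !eqxx.
rewrite delta_neq0 => /andP[/eqP gvg _].
by rewrite -gvh; apply: (mulgI g^-1); rewrite mulKg -[LHS]gvg !gnorm.
Qed.

(** If u is a descent of g, commutation with v makes N(g) nonzero at v^-1 u v too, which therefore
    lies in D_A. So u commutes with v, and so does what remains of g once its syllable in u is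
    removed. *)
Lemma parab_centralizer A g v : v \notin A -> parab A g -> g * vert v = vert v * g ->
  parab (A :&: [set u | vert u * vert v == vert v * vert u])%SET g.
Proof.
move=> vA; have [n] := ubnP (len g); elim: n g => [|n IHn] g //; rewrite ltnS => ln Ag gv.
have [->|g1] := eqVneq g 1; first exact: gen_by1.
have [u Au gu] := exists_descent Ag g1.
have [p [k [gE up p1 Ak [ku lg]]]] := descent_peel Au Ag gu.
have uvu : parab A ((vert v)^-1 * vert u * vert v).
  apply: (cocycle_support Ag (o := dg_f u)); move: gu; rewrite /descent.
  have := congr1 (fun z => cocycle (dg_f u) z (vert u)) gv; rewrite /= !cocycleM.
  rewrite !cocycle_vert => H.
  rewrite -(_ : cocycle (dg_f u) g (vert u) =
    cocycle (dg_f u) g ((vert v)^-1 * vert u * vert v)) //.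
  (* As g commutes with v, the letter v contributes equally to both sides. *)
  suff E : delta (dg_f u) v (g^-1 * vert u * g) = delta (dg_f u) v (vert u).
    by move: H; rewrite E addrC => /addrI.
  congr (if _ && _ then _ else _)%R; apply/eqP/eqP.
    move=> /(congr1 (fun z => g * z * g^-1)); rewrite gv mulgK => <-.
    by rewrite !gnorm.
  by move=> ->; rewrite -mulgA -gv mulKg.
have uv := parab_conj_commute vA (parab_vert Au) uvu.
have Cu : u \in (A :&: [set u | vert u * vert v == vert v * vert u])%SET.
  by rewrite !inE Au uv eqxx.
have Cp : p * vert v = vert v * p.
  by apply: gen_by_commute up => _ [w /= + <-]; rewrite inE => /eqP->.
rewrite gE; apply: gen_byM; first exact: parab1_sub up.
apply: IHn => //; first by rewrite -lg.
by apply: (mulgI p); rewrite !mulgA -gE gv Cp -mulgA -gE.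
Qed.

End Cosets.

(** * Edges labelled by infinity *)

Lemma all_alt (V : Type) (P : pred V) n u v : P u -> P v ->
  all (fun l : V * bool => P l.1) (alt n u v).
Proof. by elim: n u v => //= n IHn u v Pu Pv; rewrite Pu IHn. Qed.

Lemma all_nseq_true (V : Type) (P : pred V) n v : P v ->
  all (fun l : V * bool => P l.1) (nseq n (v, true)).
Proof. by move=> Pv; elim: n => //= n ->; rewrite Pv. Qed.

(* If m(a,b) = oo then no relation involves both a and b.  Hence in any action
   of D the generator a may be replaced by its conjugate under a bijection
   commuting with all generators other than a and b.  Starting from left
   multiplication on [D * seq D], the involution [swap] below yields an action
   which remembers the syllables of words in a and b. *)
Section InfiniteEdge.
Variables (D : groupType) (X : set D) (S : dyer_system X).
Local Notation G := (ds_graph S).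
Local Notation vert := (ds_vert (S := S)).
Local Notation cocycle := (cocycle S).
Local Notation parab := (parab (S := S)).
Local Notation descent := (descent (S := S)).
Local Notation word_of := (word_of S).
Variables (a b : G).
Hypotheses (ab_edge : dg_edge a b) (ab_inf : dg_m a b = None).
Implicit Types (g h p q t : D) (u v : G) (z : D * seq D).

Let C : set D := parab (~: [set a; b])%SET.

Definition swap_letter p := p != 1 /\ (parab [set a]%SET p \/ parab [set b]%SET p).

(** A syllable p in a or b moves between the list, which serves as a memory, and the group element,
    provided that the rest of the group element lies in [C]. *)
Definition swap_rel z z' := exists g p w, [/\ C g, swap_letter p &
  z = (g, p :: w) /\ z' = (g * p, w) \/ z = (g * p, w) /\ z' = (g, p :: w)].

(** The default [z] fixes every point that has no partner. *)
Definition swap z := xget z [set z' | swap_rel z z'].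

Definition ltrans g z := (g * z.1, z.2).

Lemma ab_neq : a != b.
Proof. by apply: contraTneq ab_edge => ->; rewrite dg_edge_irr. Qed.

Lemma cyclic_prod_disjoint u v p q : u \in [set a; b]%SET -> v \in [set a; b]%SET ->
  u != v -> parab [set u]%SET p -> parab [set v]%SET q -> C (p * q) -> p = 1 /\ q = 1.
Proof.
move=> uab vab uv up vq Cpq.
have p1 : p = 1.
  apply: (cyclic_faithful up); have := descentMl q up.
  rewrite (parab_disjoint_cocycle (A := (~: [set a; b])%SET)) //; last by rewrite inE uab.
  move=> /esym; have [->|/(cocycle_cyclic vq)[/vert_inj uv' _]] :=
    eqVneq (cocycle (dg_f u) q (vert u)) 0%R; first by rewrite addr0.
  by rewrite uv' eqxx in uv.
split=> //; apply: (cyclic_faithful vq); move: Cpq; rewrite p1 mul1g => Cq.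
by apply: (parab_disjoint_cocycle _ _ Cq); rewrite inE vab.
Qed.

Lemma swap_letter_notin p : swap_letter p -> ~ C p.
Proof.
have [aab bab] : a \in [set a; b]%SET /\ b \in [set a; b]%SET by rewrite !inE !eqxx orbT.
have ba : b != a by rewrite eq_sym ab_neq.
have one v : parab [set v]%SET 1 by exact: gen_by1.
move=> [/eqP p1 [vp|vp]]; rewrite -[p]mulg1 => Cp; apply: p1.
  by have [] := cyclic_prod_disjoint aab bab ab_neq vp (one b) Cp.
by have [] := cyclic_prod_disjoint bab aab ba vp (one a) Cp.
Qed.

Lemma swap_letter_inj p q : swap_letter p -> swap_letter q -> C (p / q) -> p = q.
Proof.
have [aab bab] : a \in [set a; b]%SET /\ b \in [set a; b]%SET by rewrite !inE !eqxx orbT.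
have ba : b != a by rewrite eq_sym ab_neq.
have same v : v \in [set a; b]%SET -> parab [set v]%SET p -> parab [set v]%SET q ->
    C (p / q) -> p = q.
  move=> vab vp vq Cpq; have [->|pq] := eqVneq p q => //.
  case: (@swap_letter_notin (p / q)) => //; split; first by rewrite divg_eq1.
  have : parab [set v]%SET (p / q) by apply: gen_byM => //; exact: gen_byV.
  by move: vab; rewrite !inE => /orP[/eqP->|/eqP->]; [left|right].
move=> [p1 pab] [q1 qab] Cpq; case: pab qab => [ap|bp] [aq|bq].
- exact: same aab ap aq Cpq.
- have [p1' _] := cyclic_prod_disjoint aab bab ab_neq ap (gen_byV bq) Cpq.
  by rewrite p1' eqxx in p1.
- have [p1' _] := cyclic_prod_disjoint bab aab ba bp (gen_byV aq) Cpq.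
  by rewrite p1' eqxx in p1.
- exact: same bab bp bq Cpq.
Qed.

Lemma swap_rel_sym z z' : swap_rel z z' -> swap_rel z' z.
Proof.
by move=> [u [p [w [Cu sp H]]]]; exists u, p, w; split=> //; case: H => -[-> ->]; [right|left].
Qed.

(** Syllables never lie in [C], so first components g and g p with g in [C] exclude each other.
    Syllables that agree modulo [C] are equal, so g p determines g and p. *)
Lemma swap_rel_fun z z1 z2 : swap_rel z z1 -> swap_rel z z2 -> z1 = z2.
Proof.
have prodC g p w g' p' w' : C g -> C g' -> swap_letter p' ->
    (g, p :: w) = (g' * p', w') -> False.
  move=> Cg Cg' sp' [gE _]; apply: (swap_letter_notin sp').
  have -> : p' = g'^-1 * g by rewrite gE mulKg.
  by apply: gen_byM => //; exact: gen_byV.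
move=> [u [p [w [Cu sp [[-> ->]|[-> ->]]]]]] [u' [p' [w' [Cu' sp' [[E ->]|[E ->]]]]]].
- by case: E => -> -> ->.
- by case: (prodC _ _ _ _ _ _ Cu Cu' sp' E).
- by case: (prodC _ _ _ _ _ _ Cu' Cu sp (esym E)).
- case: E => E ->; have pp' : p = p'.
    apply: swap_letter_inj => //; have -> : p / p' = u^-1 * u'.
      by apply: (mulgI u); rewrite mulgA E mulgK mulVKg.
    by apply: gen_byM => //; exact: gen_byV.
  by subst p'; move: E => /mulIg ->.
Qed.

Lemma swap_relE z z' : swap_rel z z' -> swap z = z'.
Proof.
move=> zz'; rewrite /swap; case: xgetP => [z1 _ /= zz1|]; first exact: swap_rel_fun zz1 zz'.
by move=> /(_ z').
Qed.

Lemma swapP z : swap_rel z (swap z) \/ swap z = z /\ forall z', ~ swap_rel z z'.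
Proof.
rewrite {2}/swap /swap; case: xgetP => [z1 -> zz1|H]; [by left|right].
by split=> // z' /H.
Qed.

Lemma swapK : involutive swap.
Proof.
move=> z; have [/swap_rel_sym|[zE _]] := swapP z; first exact: swap_relE.
by rewrite zE.
Qed.

Lemma swap_ltrans g z : C g -> swap (ltrans g z) = ltrans g (swap z).
Proof.
have relM h z1 z2 : C h -> swap_rel z1 z2 -> swap_rel (ltrans h z1) (ltrans h z2).
  move=> Ch [u [p [w [Cu sp H]]]]; exists (h * u), p, w; split=> //; first exact: gen_byM.
  by case: H => -[-> ->]; rewrite /ltrans /= mulgA; [left|right].
move=> Cg; have [/(relM _ _ _ Cg)|[-> H]] := swapP z; first exact: swap_relE.
have [|[//]] := swapP (ltrans g z).
move=> /(relM _ _ _ (gen_byV Cg)); rewrite {1}/ltrans /= mulKg.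
by rewrite -surjective_pairing => /H.
Qed.

Definition swap_act (l : G * bool) z :=
  if l.1 == a then swap (ltrans (letter l) (swap z)) else ltrans (letter l) z.

Lemma ltransM g h z : ltrans (g * h) z = ltrans g (ltrans h z).
Proof. by rewrite /ltrans /= mulgA. Qed.

Lemma ltrans1 z : ltrans 1 z = z.
Proof. by case: z => d w; rewrite /ltrans mul1g. Qed.

Lemma foldr_swap_actNa s z : all (fun l => l.1 != a) s ->
  foldr swap_act z s = ltrans (ev s) z.
Proof.
elim: s => [|l s IHs] /=; first by rewrite ev_nil ltrans1.
by move=> /andP[la /IHs ->]; rewrite /swap_act (negbTE la) ev_cons ltransM.
Qed.

Lemma foldr_swap_actNb s z : all (fun l => l.1 != b) s ->
  foldr swap_act z s = swap (ltrans (ev s) (swap z)).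
Proof.
elim: s => [|l s IHs] /=; first by rewrite ev_nil ltrans1 swapK.
move=> /andP[lb /IHs ->]; rewrite /swap_act ev_cons ltransM.
case: ifPn => la; first by rewrite swapK.
rewrite [RHS]swap_ltrans //.
have : C (vert l.1) by apply: parab_vert; rewrite !inE negb_or la.
by rewrite /letter; case: ifP => // _ Cl; exact: (gen_byV Cl).
Qed.

Lemma swap_act_letterK v c z : swap_act (v, c) (swap_act (v, ~~ c) z) = z.
Proof.
rewrite /swap_act /=; case: (v == a); rewrite ?swapK -ltransM.
  by case: c; rewrite /letter /= ?mulgV ?mulVg ltrans1 swapK.
by case: c; rewrite /letter /= ?mulgV ?mulVg ltrans1.
Qed.

(** No relation mentions both a and b. Words without a act by left translation, words without b by
    its conjugate under [swap]; both depend on [ev] only. *)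
Lemma swap_act_rel s s' z : dyer_rel s s' -> foldr swap_act z s = foldr swap_act z s'.
Proof.
move=> rs; suff [H|H] : all (fun l => l.1 != a) (s ++ s') \/ all (fun l => l.1 != b) (s ++ s').
- by move: H; rewrite all_cat => /andP[H H']; rewrite !foldr_swap_actNa // (ev_rel rs).
- by move: H; rewrite all_cat => /andP[H H']; rewrite !foldr_swap_actNb // (ev_rel rs).
have label_ab : dg_label a b = None by rewrite /dg_label ab_edge.
have label_ba : dg_label b a = None by rewrite /dg_label dg_edge_sym ab_edge -dg_m_sym.
case: rs => [v n _|u v n uv uvn].
  rewrite cats0; have [->|va] := eqVneq v a.
    by right; apply: (all_nseq_true (P := fun u => u != b)); exact: ab_neq.
  by left; apply: (all_nseq_true (P := fun u => u != a)).
have avoid w : u != w -> v != w -> all (fun l => l.1 != w) (alt n u v ++ alt n v u).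
  by move=> uw vw; rewrite all_cat !(all_alt (P := fun u => u != w)).
have [ua|ua] := eqVneq u a.
  right; apply: avoid; first by rewrite ua ab_neq.
  by apply: contra_eqN uvn => /eqP->; rewrite ua label_ab.
have [va|va] := eqVneq v a; last by left; exact: avoid.
right; apply: avoid; last by rewrite va ab_neq.
by apply: contra_eqN uvn => /eqP->; rewrite va label_ba.
Qed.

Definition swap_action g z := foldr swap_act z (word_of g).

Lemma swap_action_ev s z : swap_action (ev s) z = foldr swap_act z s.
Proof.
have /ev_pres_eq : ev (word_of (ev s)) = ev s by rewrite word_ofK.
apply: pres_eq_foldr => *; [exact: swap_act_letterK|exact: swap_act_rel].
Qed.

Lemma swap_actionM g h z : swap_action (g * h) z = swap_action g (swap_action h z).
Proof.
rewrite -[in LHS](word_ofK S g) -[in LHS](word_ofK S h) -ev_cat swap_action_ev.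
by rewrite foldr_cat.
Qed.

Lemma swap_action1 z : swap_action 1 z = z.
Proof. by rewrite -(ev_nil S) swap_action_ev. Qed.

Lemma cyclic_word v p : parab [set v]%SET p -> exists2 s, ev s = p & all (fun l => l.1 == v) s.
Proof.
move: p; apply: (parab_min (H := [set p | exists2 s, ev s = p & all (fun l => l.1 == v) s])).
  split=> [|_ _ [s <- vs] [s' <- vs']]; first by exists [::]; rewrite ?ev_nil.
  exists (s ++ winv s').
    rewrite ev_cat; congr (_ * _); apply: (mulgI (ev s')); rewrite mulgV -ev_cat -(ev_nil S).
    exact/ev_pres_eq/pres_eq_mulwV.
  by rewrite all_cat vs /winv all_map all_rev.
by move=> u; rewrite inE => /eqP->; exists [:: (v, true)]; rewrite ?ev_letter //= eqxx.
Qed.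

Lemma swap_action_a p z : parab [set a]%SET p ->
  swap_action p z = swap (ltrans p (swap z)).
Proof.
move=> /cyclic_word[s <- sa]; rewrite swap_action_ev; apply: foldr_swap_actNb.
by apply: sub_all sa => l /eqP->; exact: ab_neq.
Qed.

Lemma swap_action_b p z : parab [set b]%SET p -> swap_action p z = ltrans p z.
Proof.
move=> /cyclic_word[s <- sb]; rewrite swap_action_ev; apply: foldr_swap_actNa.
by apply: sub_all sb => l /eqP->; rewrite eq_sym ab_neq.
Qed.

Lemma swap_pop p w : swap_letter p -> swap (p, w) = (1, p :: w).
Proof.
move=> sp; apply: swap_relE; exists 1, p, w; split=> //; first exact: gen_by1.
by right; rewrite mul1g.
Qed.

Lemma swap_nil : swap (1, [::]) = (1, [::]).
Proof.
have [[u [p [w [Cu sp [[]//|[[E1 _] _]]]]]]|[]//] := swapP (1, [::]).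
case: (swap_letter_notin sp); have -> : p = u^-1 by rewrite (mulg1_eq (esym E1)).
exact: gen_byV.
Qed.

(** Ping-pong from the base point: a syllable in a ends up in the list and leaves 1 in front, a
    syllable in b multiplies that 1 and stays in front. The two kinds alternate, since a peeled
    generator is no descent of the remainder. *)
Lemma swap_action_descent g : parab [set a; b]%SET g ->
  (descent g a -> exists w, swap_action g (1, [::]) = (1, w)) /\
  (descent g b -> exists2 z, swap_action g (1, [::]) = z & swap_letter z.1).
Proof.
have [n] := ubnP (len S g); elim: n g => [|n IHn] g //; rewrite ltnS => ln abg.
split=> gv.
  have aab : a \in [set a; b]%SET by rewrite !inE eqxx.
  have [p [h [gE ap p1 abh [ha lg]]]] := descent_peel aab abg gv.
  have sp : swap_letter p by split=> //; left.
  rewrite gE swap_actionM swap_action_a //.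
  have [->|h1] := eqVneq h 1.
    rewrite swap_action1 swap_nil /ltrans /= mulg1 swap_pop //.
    by eexists.
  have [v vab hv] := exists_descent abh h1.
  move: vab hv; rewrite !inE => /orP[/eqP->|/eqP->]; first by rewrite (negbTE ha).
  have lh : (len S h < n)%N by rewrite -lg.
  move=> /(IHn h lh abh).2[[q w] -> /= sq].
  by rewrite swap_pop // /ltrans /= mulg1 swap_pop //; eexists.
have bab : b \in [set a; b]%SET by rewrite !inE eqxx orbT.
have [p [h [gE bp p1 abh [hb lg]]]] := descent_peel bab abg gv.
have sp : swap_letter p by split=> //; right.
rewrite gE swap_actionM swap_action_b //.
have [->|h1] := eqVneq h 1.
  by rewrite swap_action1 /ltrans mulg1; eexists.
have [v vab hv] := exists_descent abh h1.
move: vab hv; rewrite !inE => /orP[/eqP->|/eqP->]; last by rewrite (negbTE hb).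
have lh : (len S h < n)%N by rewrite -lg.
by move=> /(IHn h lh abh).1[w ->]; rewrite /ltrans mulg1; eexists.
Qed.

(** Both descents pass from g to its factor q^-1 in the subgroup of a and b. The base point would
    then be sent to a pair whose first component is 1 and also a nontrivial syllable. *)
Lemma infinite_edge_descent g : descent g a -> descent g b -> False.
Proof.
move=> ga gb; have [q [abq qr _]] := coset_min [set a; b]%SET g.
have desc v : v \in [set a; b]%SET -> descent g v -> descent q^-1 v.
  move=> vab; rewrite /descent -{1}[g](mulKg q) cocycleM qr ?addr0 //.
  by apply: gen_byJ; [exact: gen_byV|exact: parab_vert].
have aab : a \in [set a; b]%SET by rewrite !inE eqxx.
have bab : b \in [set a; b]%SET by rewrite !inE eqxx orbT.
have [/(_ (desc a aab ga))[w E] /(_ (desc b bab gb))[z]] := swap_action_descent (gen_byV abq).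
by rewrite E => <- [/=]; rewrite eqxx.
Qed.

End InfiniteEdge.

(** * Edges with a finite label *)

(* Tits' representation in its contragredient form (the numbers game).  The
   vertices with f <> 2 act trivially, and no relation constrains the entry of an
   edge labelled oo, which is set to 0. *)
Section FiniteEdge.
Variables (D : groupType) (X : set D) (S : dyer_system X).
Local Notation G := (ds_graph S).
Local Notation vert := (ds_vert (S := S)).
Implicit Types (u v r : G) (F : G -> algC).
Local Open Scope ring_scope.

(** A primitive root of unity of order 2n, so that [zeta n + (zeta n)^-1] replaces 2 cos(pi/n). The
    value at 0 is a dummy. *)
Definition zeta n : algC :=
  if n is n'.+1 then sval (C_prim_root_exists (isT : (0 < n'.+1.*2)%N)) else 1.

Lemma zetaP n : (0 < n)%N -> (n.*2).-primitive_root (zeta n).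
Proof. by case: n => // n _; exact: (svalP (C_prim_root_exists _)). Qed.

(** The negative of the usual Cartan matrix, up to the choice of the roots. At label 2 the root is a
    square root of -1 and the entry is 0. *)
Definition cartan u v : algC :=
  if u == v then - 2 else if dg_label u v is Some n then zeta n + (zeta n)^-1 else 0.

Definition tits (l : G * bool) F : G -> algC :=
  if dg_f l.1 == Some 2 then fun r => F r + cartan l.1 r * F l.1 else F.

Lemma dg_label_sym u v : dg_label u v = dg_label v u.
Proof.
rewrite /dg_label [dg_edge v u]dg_edge_sym.
by case: ifP => // uv; rewrite dg_m_sym.
Qed.

Lemma cartanC u v : cartan u v = cartan v u.
Proof. by rewrite /cartan eq_sym dg_label_sym. Qed.

Lemma cartan_diag u : cartan u u = - 2.
Proof. by rewrite /cartan eqxx. Qed.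

Lemma titsK v b F : tits (v, b) (tits (v, ~~ b) F) = F.
Proof.
rewrite /tits /=; case: (dg_f v == Some 2) => //.
apply: functional_extensionality_dep => r.
by rewrite cartan_diag; ring.
Qed.

Section Dihedral.
Variables (u v : G) (n : nat).
Hypotheses (uv : u != v) (uvn : dg_label u v = Some n) (n1 : (1 < n)%N).
Hypotheses (fu : dg_f u = Some 2) (fv : dg_f v = Some 2).

(* Up to a factor z or z^-1, u and v exchange the linear forms L and M. *)
Let z := zeta n.
Let L F := F u + z * F v.
Let M F := z * F u + F v.

Lemma zeta_neq0 : z != 0.
Proof.
have := prim_expr_order (zetaP (ltnW n1)); rewrite -/z => zn.
apply: contra_eq_neq zn => ->; rewrite expr0n double_eq0 eqn0Ngt (ltnW n1) /=.
by rewrite eq_sym oner_neq0.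
Qed.

Lemma cartanE : cartan u v = z + z^-1 /\ cartan v u = z + z^-1.
Proof. by rewrite [cartan v u]cartanC /cartan (negbTE uv) uvn. Qed.

Lemma tits_u b F : L (tits (u, b) F) = z * M F /\ M (tits (u, b) F) = z^-1 * L F.
Proof.
have [cuv _] := cartanE; rewrite /L /M /tits /= fu eqxx cuv cartan_diag.
have z0 := zeta_neq0; by split; field.
Qed.

Lemma tits_v b F : L (tits (v, b) F) = z^-1 * M F /\ M (tits (v, b) F) = z * L F.
Proof.
have [_ cvu] := cartanE; rewrite /L /M /tits /= fv eqxx cvu cartan_diag.
have z0 := zeta_neq0; split; by field.
Qed.

Lemma tits_alt k F :
  [/\ L (foldr tits F (alt k u v)) = z ^+ k * (if odd k then M F else L F),
      M (foldr tits F (alt k v u)) = z ^+ k * (if odd k then L F else M F),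
      L (foldr tits F (alt k v u)) = z^-1 ^+ k * (if odd k then M F else L F) &
      M (foldr tits F (alt k u v)) = z^-1 ^+ k * (if odd k then L F else M F)].
Proof.
elim: k => [|k [IH1 IH2 IH3 IH4]]; first by rewrite !expr0 !mul1r.
rewrite [foldr tits F (alt k.+1 u v)]/= [foldr tits F (alt k.+1 v u)]/=.
rewrite !(tits_u _ _).1 !(tits_u _ _).2 !(tits_v _ _).1 !(tits_v _ _).2.
by rewrite IH1 IH2 IH3 IH4 /= !exprS -!mulrA; case: (odd k).
Qed.

Lemma tits_span s F : all (fun l => l.1 \in [:: u; v]) s ->
  exists P Q, forall r, foldr tits F s r = F r + cartan u r * P + cartan v r * Q.
Proof.
elim: s => [|[w b] s IHs] /=; first by exists 0, 0 => r; rewrite !mulr0 !addr0.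
move=> /andP[+ /IHs[P [Q H]]]; rewrite !inE => /orP[/eqP->|/eqP->].
  exists (P + foldr tits F s u), Q => r; rewrite /tits /= fu eqxx H -/tits.
  by rewrite mulrDr; ring.
exists P, (Q + foldr tits F s v) => r; rewrite /tits /= fv eqxx H -/tits.
by rewrite mulrDr; ring.
Qed.

Lemma tits_LM_inj F F' : z ^+ 2 != 1 -> L F = L F' -> M F = M F' -> F u = F' u /\ F v = F' v.
Proof.
move=> z2 LE ME; have z20 : 1 - z ^+ 2 != 0 by rewrite subr_eq0 eq_sym.
split; apply: (mulfI z20).
  have -> : (1 - z ^+ 2) * F u = L F - z * M F by rewrite /L /M; ring.
  by rewrite LE ME /L /M; ring.
have -> : (1 - z ^+ 2) * F v = M F - z * L F by rewrite /L /M; ring.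
by rewrite LE ME /L /M; ring.
Qed.

Lemma zeta_sq : z ^+ 2 != 1.
Proof.
rewrite -(prim_order_dvd (zetaP (ltnW n1))).
apply/negP => /(dvdn_leq (isT : (0 < 1.*2)%N)).
by rewrite leq_double leqNgt n1.
Qed.

(** Both sides agree on L and M because z^n = z^-n, hence at u and v. The 2 x 2 Cartan block of u
    and v is invertible, so the scalars from [tits_span] agree too, and with them all entries. *)
Lemma tits_braid F : foldr tits F (alt n u v) = foldr tits F (alt n v u).
Proof.
have [L1 M2 L2 M1] := tits_alt n F.
have zn : z ^+ n = z^-1 ^+ n.
  apply: (mulfI (expf_neq0 n zeta_neq0)).
  rewrite exprVn mulfV ?expf_neq0 ?zeta_neq0 // -exprD addnn.
  exact: prim_expr_order (zetaP (ltnW n1)).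
have [Fu Fv] := tits_LM_inj zeta_sq (etrans L1 (etrans (congr1 (fun x => x * _) zn) (esym L2)))
  (etrans M1 (etrans (congr1 (fun x => x * _) (esym zn)) (esym M2))).
have alt_uv k : all (fun l => l.1 \in [:: u; v]) (alt k u v) /\
    all (fun l => l.1 \in [:: u; v]) (alt k v u).
  by split; apply: (all_alt (P := fun w => w \in [:: u; v])); rewrite !inE eqxx ?orbT.
have [P [Q H]] := tits_span F (alt_uv n).1.
have [P' [Q' H']] := tits_span F (alt_uv n).2.
have [cuv cvu] := cartanE.
have [PE QE] : P = P' /\ Q = Q'.
  move: Fu Fv; rewrite !H !H' !cartan_diag cuv cvu => Eu Ev.
  (* Up to sign this is the determinant of the Cartan block. *)
  have det : (z - z^-1) ^+ 2 != 0.
    rewrite expf_eq0 /= subr_eq0; apply: contra zeta_sq => /eqP zz.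
    by rewrite expr2 {2}zz mulfV // zeta_neq0.
  have z0 := zeta_neq0.
  have c2 : (z + z^-1) ^+ 2 - 4 = (z - z^-1) ^+ 2 by field.
  have EP : 2 * (P - P') = (z + z^-1) * (Q - Q').
    move: Eu => /eqP; rewrite -subr_eq0 => /eqP E; apply/eqP.
    by rewrite -subr_eq0 -oppr_eq0 -[X in _ == X]E; apply/eqP; ring.
  have EQ : 2 * (Q - Q') = (z + z^-1) * (P - P').
    move: Ev => /eqP; rewrite -subr_eq0 => /eqP E; apply/eqP.
    by rewrite -subr_eq0 -oppr_eq0 -[X in _ == X]E; apply/eqP; ring.
  split; apply/eqP; rewrite -subr_eq0; apply/eqP; apply: (mulfI det); rewrite mulr0 -c2.
    have -> : ((z + z^-1) ^+ 2 - 4) * (P - P') =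
      (z + z^-1) * ((z + z^-1) * (P - P')) - 2 * (2 * (P - P')) by ring.
    by rewrite -EQ EP; ring.
  have -> : ((z + z^-1) ^+ 2 - 4) * (Q - Q') =
    (z + z^-1) * ((z + z^-1) * (Q - Q')) - 2 * (2 * (Q - Q')) by ring.
  by rewrite -EP EQ; ring.
by apply: functional_extensionality_dep => r; rewrite H H' PE QE.
Qed.

(** On the indicator function of u, where L is 1, commutation gives z^2 = z^-2, but z has order 2n >
    4. *)
Lemma tits_Ncommute : (2 < n)%N ->
  ~ forall F, foldr tits F (alt 2 u v) = foldr tits F (alt 2 v u).
Proof.
move=> n2 H; pose F r : algC := (r == u)%:R.
have LF : L F = 1 by rewrite /L /F eqxx eq_sym (negbTE uv) mulr0 addr0.
have [L1 _ L2 _] := tits_alt 2 F.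
move: L2; rewrite -H L1 /= LF !mulr1 => z2.
have z0 := zeta_neq0.
have : z ^+ 4 == 1.
  by rewrite (exprD z 2 2) {2}z2 -exprMn_comm ?mulfV ?expr1n //; exact: mulrC.
rewrite -(prim_order_dvd (zetaP (ltnW n1))) => /(dvdn_leq (isT : (0 < 2.*2)%N)).
by rewrite leq_double leqNgt n2.
Qed.

End Dihedral.

Lemma tits_rel s s' F : dyer_rel s s' -> foldr tits F s = foldr tits F s'.
Proof.
case=> [v n fv|u v n uv uvn].
  have [fv2|fv2] := eqVneq (dg_f v) (Some 2).
    by move: fv; rewrite fv2 => -[<-]; exact: (titsK v true).
  by elim: n {fv} => //= n ->; rewrite /tits /= (negbTE fv2).
have [e|Ne] := boolP (dg_edge u v).
  move: (uvn); rewrite /dg_label e => m.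
  have [fu fv] := finite_label_order e m.
  apply: tits_braid => //; have := dg_m_gt2 e; rewrite m.
  exact: ltnW.
move: (uvn); rewrite /dg_label (negbTE Ne) => -[n2]; subst n.
have [fu|fu] := eqVneq (dg_f u) (Some 2); last by rewrite /= {1 4}/tits /= (negbTE fu).
have [fv|fv] := eqVneq (dg_f v) (Some 2); last by rewrite /= {2 3}/tits /= (negbTE fv).
exact: tits_braid.
Qed.

(** For label oo, commuting generators would both be descents of u v. For a finite label the numbers
    game distinguishes u v from v u. *)
Lemma edge_Ncommute u v : dg_edge u v -> (vert u * vert v)%g <> (vert v * vert u)%g.
Proof.
move=> e; have uv : u != v by apply: contraTneq e => ->; rewrite dg_edge_irr.
case m: (dg_m u v) => [n|] uvC; last first.
  apply: (infinite_edge_descent e m (g := (vert u * vert v)%g)).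
    rewrite /descent descentMl ?cocycle_vert; last by apply: parab_vert; rewrite inE.
    by rewrite /delta !eqxx (inj_eq (@vert_inj _ _ S)) (negbTE uv) addr0 oner_neq0.
  rewrite /descent uvC descentMl ?cocycle_vert; last by apply: parab_vert; rewrite inE.
  by rewrite /delta !eqxx (inj_eq (@vert_inj _ _ S)) [v == u]eq_sym (negbTE uv) addr0 oner_neq0.
have n2 : (2 < n)%N by have := dg_m_gt2 e; rewrite m.
have [fu fv] := finite_label_order e m.
have uvn : dg_label u v = Some n by rewrite /dg_label e.
apply: (tits_Ncommute uv uvn (ltnW n2) fu fv n2) => F.
have /ev_pres_eq : ev (alt 2 u v) = ev (alt 2 v u).
  by rewrite /= !ev_cons ev_nil /letter /= !mulg1.
apply: pres_eq_foldr => *; [exact: titsK|exact: tits_rel].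
Qed.

End FiniteEdge.

(** * Finite standard parabolic subgroups *)

Section Finiteness.
Variables (D : groupType) (X : set D) (S : dyer_system X).
Local Notation G := (ds_graph S).
Local Notation vert := (ds_vert (S := S)).
Local Notation cocycle := (cocycle S).
Local Notation parab := (parab (S := S)).
Local Notation descent := (descent (S := S)).
Local Notation len := (len S).
Implicit Types (g h p q t : D) (u v : G) (A B C U : {set G}).

(** For disjoint A and B this says, in terms of cuts, that every vertex of A is joined to B within
    their union. *)
Definition edge_connected A B := forall C, C \subset A -> C != finset.set0 ->
  exists u v, [/\ u \in C, v \in (A :|: B)%SET, v \notin C & dg_edge u v].

(* A vertex s of A adjacent to some b in B is moved from A to B: the
   centralizer of b in D_A lies in D_{A \ s}, so that D_{A \ s} has finite
   index in D_A and finite orbit at s. *)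
Lemma finite_parab A B : (forall v, v \in A -> v \notin B) -> edge_connected A B ->
  (forall b, b \in B -> finite_set [set g * vert b * g^-1 | g in parab A]) ->
  finite_set (parab A).
Proof.
have [n] := ubnP #|A|; elim: n A B => [|n IHn] A B //; rewrite ltnS => cA AB conn orb.
have [A0|A0] := eqVneq A finset.set0.
  apply: sub_finite_set (finite_set1 (1 : D)); rewrite A0.
  apply: parab_min => [|v]; last by rewrite inE.
  by split=> [|x y -> ->] //=; rewrite mulgV.
have [s [b [As ABb Ab sb]]] := conn A (fintype.subxx A) A0.
have Bb : b \in B by move: ABb; rewrite inE (negbTE Ab).
have cent g : parab A g -> g * vert b = vert b * g -> parab (A :\ s)%SET g.
  move=> Ag /(parab_centralizer Ab Ag); apply: parabS.
  apply/fintype.subsetP => u; rewrite !inE => /andP[-> /eqP uC]; rewrite andbT.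
  by apply: contra_not_neq (edge_Ncommute sb) => us; rewrite -us.
have sub : parab (A :\ s)%SET `<=` parab A by exact: (parabS (finset.subD1set A s)).
have fA' : finite_set (parab (A :\ s)%SET).
  apply: (IHn _ (s |: B)%SET) => [||C CA C0|u].
  - by rewrite (leq_trans _ cA) // [X in (_ <= X)%N](cardsD1 s) As.
  - by move=> v; rewrite !inE negb_or => /andP[-> /AB].
  - have [u [v [Cu ABv Cv uv]]] := conn C (fintype.subset_trans CA (finset.subD1set A s)) C0.
    exists u, v; split=> //; move: ABv; rewrite !inE => /orP[->|->]; last by rewrite !orbT.
    by case: (v == s).
  rewrite !inE => /orP[/eqP->|/orb]; last first.
    by apply: sub_finite_set => _ [g Ag <-]; exists g => //; exact: sub.
  (* If g s and h s conjugate b alike, then g^-1 h commutes with s. So the orbit of s under D_{A \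
     s} factors through the finite orbit of b. *)
  apply: (finite_image_factor (p := fun g => (g * vert s) * vert b * (g * vert s)^-1)).
    move=> g h A'g A'h gh.
    have A'v : parab (A :\ s)%SET (g^-1 * h) by apply: gen_byM => //; exact: gen_byV.
    have A'c : parab (A :\ s)%SET ((vert s)^-1 * (g^-1 * h) * vert s).
      apply: cent; first by apply: gen_byJ; [exact: parab_vert|exact: sub].
      have := congr1 (fun z => (vert s)^-1 * g^-1 * z * (h * vert s)) gh.
      by rewrite !gnorm => <-.
    have sA' : s \notin (A :\ s)%SET by rewrite !inE eqxx.
    have vs := parab_conj_commute sA' A'v A'c.
    have hE : h = g * (g^-1 * h) by rewrite mulVKg.
    rewrite [in RHS]hE invgM mulgA -(mulgA g _ (vert s)) vs.
    by rewrite !gnorm.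
  apply: sub_finite_set (orb b Bb) => _ [g A'g <-]; exists (g * vert s) => //.
  by apply: gen_byM; [exact: sub|exact: parab_vert].
(* [r] picks one element of D_A for each point of the orbit of b; two elements with the same point
   differ by the centralizer of b, inside D_{A \ s}. *)
pose r t := xget 1 [set g | parab A g /\ g * vert b * g^-1 = t].
apply: sub_finite_set (finite_image2 (fun t h => r t * h) (orb b Bb) fA') => g Ag.
exists (g * vert b * g^-1); first by exists g.
exists ((r (g * vert b * g^-1))^-1 * g); last by rewrite mulVKg.
rewrite /r; case: xgetP => [h _ [Ah hE]|]; last by move=> /(_ g)/=; case.
apply: cent; first by apply: gen_byM => //; exact: gen_byV.
have := congr1 (fun z => h^-1 * z * g) hE.
by rewrite !gnorm.
Qed.

Lemma finite_max_descent A : finite_set (parab A) ->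
  exists2 g, parab A g & forall v, v \in A -> descent g v.
Proof.
move=> /finite_seqP[s sE].
pose Q n := `[< exists2 g, parab A g & len g = n >].
have exQ : exists n, Q n by exists (len 1); apply/asboolP; exists 1 => //; exact: gen_by1.
have ubQ n : Q n -> (n <= \max_(g <- s) len g)%N.
  move=> /asboolP[g Ag <-]; apply: leq_bigmax_seq => //.
  by move: Ag; rewrite sE.
have [m /asboolP[g Ag gm] mmax] := ex_maxnP exQ ubQ.
exists g => // v Av; apply: contraT => gv.
have vv : parab [set v]%SET (vert v) by apply: parab_vert; rewrite inE.
have : (len (vert v * g) <= m)%N.
  apply: mmax; apply/asboolP; exists (vert v * g) => //.
  by apply: gen_byM => //; exact: parab_vert.
by rewrite (len_Ndescent gv vv (vert_neq1 v)) gm ltnn.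
Qed.

(** * Longest elements when all generators have order 2 *)

Section Order2.
Variable U : {set G}.
Hypothesis U2 : forall v, v \in U -> dg_f v = Some 2.

Lemma order2_cyclic t p : t * t = 1 -> gen_by [set t] p -> p = 1 \/ p = t.
Proof.
move=> tt; move: p; apply: (gen_by_min (H := [set p | p = 1 \/ p = t])) => [|p ->]; last by right.
split=> [|x y /= xt yt]; first by left.
have -> : y^-1 = y by case: yt => ->; [exact: invg1|exact: mulg1_eq].
by case: xt yt => -> [->|->]; rewrite ?mul1g ?mulg1 ?tt; [left|right|right|left].
Qed.

Lemma order2_parab1 v p : v \in U -> parab [set v]%SET p -> p != 1 -> p = vert v.
Proof.
move=> /U2 fv vp p1.
have : gen_by [set vert v] p.
  by move: p vp {p1}; apply: gen_by_le => _ [u /= + <-]; rewrite inE => /eqP->.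
by move=> /(order2_cyclic (vert_mulgg fv))[E|//]; rewrite E eqxx in p1.
Qed.

Lemma order2_word g : parab U g -> word_in [set vert v | v in [set` U]] g (len g).
Proof.
have [n] := ubnP (len g); elim: n g => [|n IHn] g //; rewrite ltnS => ln Ug.
have [->|g1] := eqVneq g 1; first by rewrite len1; apply/word_in0.
have [v Uv gv] := exists_descent Ug g1.
have [p [h [gE vp p1 Uh [_ lg]]]] := descent_peel Uv Ug gv.
rewrite lg; apply/word_in_cons; exists p, h; split=> //.
  by exists v => //; rewrite (order2_parab1 Uv vp p1).
by apply: IHn => //; rewrite -lg.
Qed.

(** A syllable is now a single letter, so the length used in [longest] is the syllable length. *)
Lemma order2_word_length g : parab U g -> word_length [set vert v | v in [set` U]] g = len g.
Proof.
move=> Ug; have [Ul le] := word_lengthP (order2_word Ug).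
apply/eqP; rewrite eqn_leq le /=; apply: rel_length_le.
apply: word_in_sub Ul => _ [v _ <-]; exists v; rewrite ?inE //.
by apply: parab_vert; rewrite inE.
Qed.

Section Longest.
Variable w : D.
Hypotheses (Uw : parab U w) (wU : forall v, v \in U -> descent w v).

(** Induction on g = v k with w = k h. As v is a descent of w but not of k, N(h) is nonzero at t =
    k^-1 v k. Exchange shortens h to t h, and w = g (t h). *)
Lemma longest_factor g : parab U g -> exists2 h, w = g * h & len w = (len g + len h)%N.
Proof.
have [n] := ubnP (len g); elim: n g => [|n IHn] g //; rewrite ltnS => ln Ug.
have [->|g1] := eqVneq g 1; first by exists w; rewrite ?mul1g ?len1.
have [v Uv gv] := exists_descent Ug g1.
have [p [k [gE vp p1 Uk [kv lg]]]] := descent_peel Uv Ug gv.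
have lk : (len k < n)%N by rewrite -lg.
have [h wE lw] := IHn k lk Uk.
have pE := order2_parab1 Uv vp p1.
pose t := k^-1 * vert v * k.
have tt : t * t = 1 by rewrite /t !gnorm -(mulgA _ (vert v) (vert v)) vert_mulgg ?U2 // mulg1 mulVg.
have ht : cocycle (dg_f v) h t != 0%R.
  move: (wU Uv); rewrite /descent wE cocycleM.
  by move: kv; rewrite /descent negbK => /eqP->; rewrite add0r.
have [q /(order2_cyclic tt)[->|->]] := exchange_len ht; first by rewrite mul1g ltnn.
move=> lth; have wgt : w = g * (t * h).
  rewrite gE pE wE /t !gnorm vert_mulgg ?U2 // mul1g.
  by [].
exists (t * h) => //; apply/eqP; rewrite eqn_leq {1}wgt lenM /= lw lg.
by rewrite addSn -addnS leq_add2l.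
Qed.

Lemma longest_descent : longest [set vert v | v in [set` U]] w.
Proof.
split=> // g Ug; rewrite !order2_word_length //.
by have [h _ ->] := longest_factor Ug; exact: leq_addr.
Qed.

Lemma finite_parab_descent : finite_set (parab U).
Proof.
have fU : finite_set (1 |` [set vert v | v in [set` U]]).
  by rewrite finite_setU; split; [exact: finite_set1|exact: finite_image].
apply: sub_finite_set (finite_word_in (len w) fU) => g Ug /=.
(* Words are padded with the letter 1 up to the exact length [len w]. *)
have pad n : word_in (1 |` [set vert v | v in [set` U]]) 1 n.
  elim: n => [|n IHn]; first exact/word_in0.
  by apply/word_in_cons; exists 1, 1; rewrite mulg1; split=> //; left.
have [h _ ->] := longest_factor Ug.
rewrite -[X in word_in _ X]mulg1; apply: word_in_cat (pad _).
by apply: word_in_sub (order2_word Ug) => x; right.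
Qed.

End Longest.
End Order2.
End Finiteness.

(** * Ribbons *)

Section RibbonTheorem.
Variables (D : groupType) (X : set D) (S : dyer_system X).
Local Notation G := (ds_graph S).
Local Notation vert := (ds_vert (S := S)).
Local Notation cocycle := (cocycle S).
Local Notation parab := (parab (S := S)).
Local Notation reduced := (reduced (S := S)).
Local Notation descent := (descent (S := S)).
Local Notation len := (len S).
Local Notation verts A := [set vert v | v in [set` A]].
Implicit Types (g h p q t : D) (u v : G) (A B C U : {set G}).

Lemma ribbon_cat Y Z Z' r s : ribbon S Y Z r -> ribbon S Z Z' s -> ribbon S Y Z' (s * r).
Proof.
move=> YZ; elim=> [_|Z1 Z2 r1 s1 _ IH e]; first by rewrite mul1g.
by rewrite -mulgA; apply: RibbonCons IH e.
Qed.

Lemma verts_sub A : verts A `<=` X.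
Proof. by move=> _ [v _ <-]; exact: vertX. Qed.

Lemma vertsP A v : verts A (vert v) <-> v \in A.
Proof. by split=> [[u Au /vert_inj<-]//|Av]; exists v. Qed.

Lemma parab_split A B g :
  (forall u v, u \in A -> v \in B -> vert u * vert v = vert v * vert u) ->
  parab (A :|: B)%SET g -> exists p q, [/\ parab A p, parab B q & g = p * q].
Proof.
move=> AB; have comm p q : parab A p -> parab B q -> p * q = q * p.
  move=> Ap Bq; apply: (gen_by_commute (Y := verts A)) Ap => _ [u Au <-].
  apply/esym; apply: (gen_by_commute (Y := verts B)) Bq => _ [v Bv <-].
  exact: (esym (AB _ _ Au Bv)).
move: g; apply: (parab_min (H := [set g | exists p q, [/\ parab A p, parab B q & g = p * q]])).
  split; first by exists 1, 1; rewrite mulg1; split=> //; exact: gen_by1.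
  move=> _ _ [p [q [Ap Bq ->]]] [p' [q' [Ap' Bq' ->]]].
  have Aq := gen_byM Ap (gen_byV Ap'); have Bqq := gen_byM Bq (gen_byV Bq').
  exists (p / p'), (q / q'); split=> //.
  rewrite invgM -!mulgA; congr (_ * _).
  by rewrite !mulgA -(mulgA p'^-1) -comm ?mulgA //; exact: gen_byV.
move=> v; rewrite inE => /orP[Av|Bv].
  by exists (vert v), 1; rewrite mulg1; split=> //; [exact: parab_vert|exact: gen_by1].
by exists 1, (vert v); rewrite mul1g; split=> //; [exact: gen_by1|exact: parab_vert].
Qed.

Lemma descent_neq1 g v : descent g v -> g != 1.
Proof. by apply: contraTneq => ->; rewrite /descent cocycle1 eqxx. Qed.

Lemma reducedS A B g : A \subset B -> reduced B g -> reduced A g.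
Proof. by move=> AB Bg o t At; apply: Bg; exact: parabS At. Qed.

Lemma connect_invariant (T : finType) (e : rel T) (P : T -> Prop) (x y : T) :
  (forall a b, P a -> e a b -> P b) -> P x -> connect e x y -> P y.
Proof.
move=> Pe Px /connectP[p + ->]; elim: p x Px => //= z p IHp x Px /andP[xz].
exact/IHp/(Pe x).
Qed.

(** * The ribbon attached to one descent *)

Section RibbonStep.
Variables (A : {set G}) (x : G) (j : D).
Local Notation I := (x |: A)%SET.
Hypotheses (xA : x \notin A) (Ij : parab I j) (jA : reduced A j) (jx : descent j x).
Hypothesis jconj : forall v, v \in A ->
  exists2 u, u \in I & j^-1 * vert v * j = vert u.

(** For a generator v of D_A, compute N of v j = j u in both ways: since u = j^-1 v j, the
    contributions of v and u cancel. *)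
Lemma cocycle_invariant o g t : parab A g -> cocycle o j (g^-1 * t * g) = cocycle o j t.
Proof.
move=> Ag; move: g Ag o t.
apply: (parab_min (H := [set g | forall o t, cocycle o j (g^-1 * t * g) = cocycle o j t])).
  split=> [o t|g h /= jg jh o t]; first by rewrite !gnorm.
  by rewrite -[in RHS]jg -[in LHS]jh !gnorm.
move=> v Av o t; have [u Iu ju] := jconj Av.
have vj : vert v * j = j * vert u by rewrite -ju !gnorm.
have NE o' t' : (delta o' v t' + cocycle o' j ((vert v)^-1 * t' * vert v) =
    cocycle o' j t' + delta o' u (j^-1 * t' * j)%g)%R.
  by rewrite -!cocycle_vert -!cocycleM vj.
(* N(j) vanishes at v and at v^-1 v v, so the coefficient 1 of v j at v must come from u. *)
have fuv : dg_f v = dg_f u.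
  have := NE (dg_f v) (vert v); rewrite -mulgA mulKg !jA; [|exact: parab_vert..].
  rewrite addr0 add0r ju => H.
  have : delta (dg_f v) u (vert u) != 0%R by rewrite -H delta_neq0 !eqxx.
  by rewrite delta_neq0 => /andP[_ /eqP].
have := NE o t; rewrite [in LHS]addrC.
suff -> : delta o u (j^-1 * t * j) = delta o v t by move/addIr.
rewrite /delta fuv; congr (if _ && _ then _ else _)%R; rewrite -ju.
apply/eqP/eqP => [/(congr1 (fun z => j * z * j^-1))|->//].
by rewrite !gnorm.
Qed.

Lemma direct_ribbonI : is_ribbon_elt S (verts A) (vert x) j^-1 ->
  ribbon S (verts A) (conj_by j^-1 (verts A)) j^-1.
Proof.
move=> rj; rewrite -[X in ribbon _ _ _ X]mulg1.
apply: RibbonCons (RibbonNil _ _) _; first exact: verts_sub.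
left; split; first exact: verts_sub.
exists (vert x); split=> //; first exact: vertX.
- by move=> /vertsP; exact/negP.
- move=> _ [_ [v Av <-] <-]; have [u] := jconj Av.
  rewrite invgK => Iu ->; move: Iu; rewrite !inE => /orP[/eqP->|Au]; first by left.
  by right; apply/vertsP.
- by rewrite conj_by_gen_by.
Qed.

Lemma component_verts : component S (vert x |` verts A) (vert x) =
  verts [set v | connect [rel u v | [&& dg_edge u v, u \in I & v \in I]] x v]%SET.
Proof.
have IE v : (vert v \in vert x |` verts A) = (v \in I).
  rewrite !inE; apply/idP/idP => [/set_mem[/vert_inj->|/vertsP->]|/orP[/eqP->|Av]].
  - by rewrite eqxx.
  - by rewrite orbT.
  - by apply/mem_set; left.
  - by apply/mem_set; right; apply/vertsP.
have eE : full_edge (vert x |` verts A) =2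
    [rel u v : G | [&& dg_edge u v, u \in I & v \in I]].
  by move=> u v; rewrite /full_edge /= !IE.
apply/seteqP; split=> [_ [u [v [/vert_inj<- -> uv]]]|_ [v + <-]].
  by exists v => //; rewrite /= inE -(eq_connect eE).
by rewrite /= inE -(eq_connect eE) => xv; exists x, v.
Qed.

(** An edge between x and v in A would be labelled oo, with both ends descents of v j. So x commutes
    with A, j is a power of x, and x is an elementary ribbon from A to itself. *)
Lemma ribbon_step_order_gt2 : ltn_inf 2 (dg_f x) ->
  ribbon S (verts A) (conj_by j^-1 (verts A)) j^-1.
Proof.
move=> fx; have xv v : v \in A -> x != v by move=> Av; apply: contraNneq xA => ->.
have Nedge v : v \in A -> ~~ dg_edge x v.
  move=> Av; apply/negP; rewrite dg_edge_sym => vx.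
  have vv : parab [set v]%SET (vert v) by apply: parab_vert; rewrite inE.
  apply: (infinite_edge_descent vx (dg_f_m vx fx) (g := vert v * j)).
    rewrite /descent descentMl // jA ?addr0; last exact: parab_vert.
    by rewrite cocycle_vert delta_neq0 !eqxx.
  rewrite /descent cocycleM cocycle_invariant; last exact: parab_vert.
  rewrite cocycle_vert /delta (inj_eq (@vert_inj _ _ S)) (negbTE (xv v Av)).
  by rewrite add0r.
have comm u v : u \in [set x]%SET -> v \in A -> vert u * vert v = vert v * vert u.
  by rewrite inE => /eqP-> Av; apply: dyer_commute; [exact: xv|exact: Nedge].
have [p [q [xp Aq jE]]] := parab_split comm Ij.
have pC v : v \in A -> p * vert v = vert v * p.
  by move=> Av; apply: gen_by_commute xp => _ [u /= xu <-]; exact: comm.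
(* A descent of q in A would give p^-1 a nonzero coefficient there, as N(j) vanishes on D_A; but
   powers of x have coefficients at x only. *)
have q1 : q = 1.
  apply/eqP; apply: contraT => q1; have [v Av] := exists_descent Aq q1.
  have -> : q = p^-1 * j by rewrite jE mulKg.
  rewrite /descent cocycleM invgK jA ?addr0; last first.
    by rewrite pC // mulgK; exact: parab_vert.
  move=> /(cocycle_cyclic (gen_byV xp))[/vert_inj vx _].
  by move: xA; rewrite -vx Av.
have {jE q1} jp : j = p by rewrite jE q1 mulg1.
have conj_p r : parab [set x]%SET r -> conj_by r (verts A) = verts A.
  move=> xr; have rC v : v \in A -> r * vert v * r^-1 = vert v.
    move=> Av; rewrite (gen_by_commute (Y := verts [set x]%SET) _ xr) ?mulgK //.
    by move=> _ [u /= xu <-]; exact: comm.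
  apply/seteqP; split=> [_ [_ [v Av <-] <-]|_ [v Av <-]].
    by rewrite rC //; exists v.
  by exists (vert v); [exists v|exact: rC].
have xx : parab [set x]%SET (vert x) by apply: parab_vert; rewrite inE.
have dx : direct_ribbon S (verts A) (verts A) (vert x).
  split; first exact: verts_sub.
  exists (vert x); split; [exact: vertX| |split| |]; last first.
  - by rewrite conj_by_gen_by conj_p.
  - by move=> y; right.
  - by right; rewrite elt_order_vert.
  - have UE y : component S (vert x |` verts A) (vert x) y -> y = vert x.
      rewrite component_verts => -[v + <-]; rewrite /= inE => xv'.
      congr (vert _); apply: (connect_invariant (P := fun w => w = x)) xv' => // u w -> /=.
      rewrite !inE => /and3P[xw _ /orP[/eqP//|Aw]].
      by have := Nedge w Aw; rewrite xw.
    split=> [u v /and3P[uv /set_mem/UE/vert_inj ux /set_mem/UE/vert_inj vx]|].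
      by move: uv; rewrite ux vx dg_edge_irr.
    apply: sub_finite_set (finite_set1 (1 : D)).
    apply: gen_by_min => [|y [/UE-> ]]; first by split=> [|y z -> ->] //=; rewrite mulgV.
    by rewrite elt_order_vert => fx2; rewrite fx2 in fx.
  - by move=> /vertsP; exact/negP.
have [_ xr] : ribbon S (verts A) (verts A) p /\ ribbon S (verts A) (verts A) p^-1.
  move: p xp {jp pC}; apply: (parab_min (H := [set p |
    ribbon S (verts A) (verts A) p /\ ribbon S (verts A) (verts A) p^-1])).
    split=> [|r s /= [r1 r2] [s1 s2]] /=.
      by rewrite invg1; split; apply: RibbonNil; exact: verts_sub.
    by rewrite invgF; split; [exact: (ribbon_cat s2 r1)|exact: (ribbon_cat r2 s1)].
  move=> v; rewrite inE => /eqP->.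
  have R0 := RibbonNil S (verts_sub (A := A)).
  split; rewrite -[X in ribbon _ _ _ X]mulg1; apply: RibbonCons R0 _; first by left.
  by right; rewrite invgK.
by rewrite jp conj_p //; exact: gen_byV.
Qed.

Lemma ribbon_step_order2 : dg_f x = Some 2 ->
  ribbon S (verts A) (conj_by j^-1 (verts A)) j^-1.
Proof.
move=> fx; apply: direct_ribbonI.
set e := [rel u v : G | [&& dg_edge u v, u \in I & v \in I]].
pose U := [set v | connect e x v]%SET; pose U' := (U :\ x)%SET.
have Ux : x \in U by rewrite inE connect0.
have Ix : x \in I by rewrite !inE eqxx.
have UI v : v \in U -> v \in I.
  rewrite inE => xv; apply: (connect_invariant (P := fun w => w \in I)) xv => // u w _.
  by case/and3P.
have Uedge u v : u \in U -> v \in I -> dg_edge u v -> v \in U.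
  move=> Uu Iv uv; have Iu := UI _ Uu; move: Uu; rewrite !inE => xu.
  by apply: connect_trans xu _; apply: connect1; rewrite /= uv Iu.
have U'A v : v \in U' -> v \in A.
  by rewrite 2!inE => /andP[vx /UI]; rewrite !inE (negbTE vx).
have U'sA : U' \subset A by apply/fintype.subsetP.
have U'sU : U' \subset U by exact: finset.subD1set.
(* If no edge left C, no path from x would enter C, although C lies in the component of x. *)
have conn : edge_connected U' [set x]%SET.
  move=> C CU' C0; have [v Cv] := set0Pn _ C0.
  have CU w : w \in C -> w \in U by move=> /(fintype.subsetP CU')/(fintype.subsetP U'sU).
  apply: contrapT => NC.
  have : v \in U /\ v \notin C.
    have := CU v Cv; rewrite {1}inE.
    apply: (connect_invariant (P := fun w => w \in U /\ w \notin C)) => [u w [Uu Cu]|].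
      move=> /and3P[uw _ Iw]; split; first exact: Uedge uw.
      apply/negP => Cw; apply: NC; exists w, u; split=> //; last by rewrite dg_edge_sym.
      by move: Uu; rewrite !inE; case: (u == x); rewrite ?orbT // => ->.
    by split=> //; apply/negP => /(fintype.subsetP CU'); rewrite !inE eqxx.
  by rewrite Cv => -[].
(* Split j = p q along U and the rest of I, which commute. A descent of q^-1 would appear in p =
   q^-1 j, as N(j) vanishes on D_A; but p lies in D_U. *)
have Uj : parab U j.
  have comm u v : u \in U -> v \in (I :\: U)%SET -> vert u * vert v = vert v * vert u.
    rewrite [v \in _]inE => Uu /andP[NUv Iv]; apply: dyer_commute.
      by apply: contraNneq NUv => <-.
    by apply: contra NUv; exact: Uedge.
  have IE : I = (U :|: (I :\: U))%SET.
    apply/setP => v; rewrite [RHS]inE [v \in (_ :\: _)%SET]inE.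
    by have [/UI->|] := boolP (v \in U).
  move: Ij; rewrite {1}IE => /(parab_split comm)[p [q [Up IUq jE]]].
  suff q1 : q = 1 by rewrite jE q1 mulg1.
  have IUA : (I :\: U \subset A)%SET.
    apply/fintype.subsetP => v; rewrite !inE => /andP[Nv /orP[/eqP vx|//]].
    by rewrite vx connect0 in Nv.
  have qp : q * p = p * q.
    apply/esym; apply: (gen_by_commute (Y := verts U)) Up => _ [u Uu <-].
    apply/esym; apply: (gen_by_commute (Y := verts (I :\: U)%SET)) IUq => _ [v IUv <-].
    exact/esym/comm.
  have pE : p = q^-1 * j by rewrite jE -qp mulKg.
  apply/eqP; rewrite -invg_eq1; apply: contraT => qV.
  have [v IUv] := exists_descent (gen_byV IUq) qV.
  have Uv : v \notin U by move: IUv; rewrite inE => /andP[].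
  have := parab_disjoint_cocycle (dg_f v) Uv Up.
  rewrite {1}pE cocycleM invgK jA ?addr0.
    by rewrite /descent => ->; rewrite eqxx.
  apply: (parabS IUA); apply: gen_byJV => //; exact: parab_vert.
(* By invariance the orbit of x lies in the finite support of N(j). *)
have fU' : finite_set (parab U').
  apply: finite_parab conn _ => [v|b].
    by rewrite !inE => /andP[].
  rewrite inE => /eqP->.
  apply: sub_finite_set (finite_cocycle_support S (dg_f x) j) => _ [g U'g <-] /=.
  rewrite -(@cocycle_invariant _ g _ (parabS U'sA U'g)).
  by rewrite !gnorm.
have [w' U'w' w'desc] := finite_max_descent fU'.
pose w := w' * j.
have wdesc v : v \in U -> descent w v.
  move=> Uv; rewrite /descent cocycleM cocycle_invariant; last exact: parabS U'w'.
  have [vx|vx] := eqVneq v x.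
    rewrite vx (parab_disjoint_cocycle _ (A := U')) ?add0r //.
    by rewrite !inE eqxx.
  have U'v : v \in U' by rewrite 2!inE vx.
  by rewrite jA ?addr0; [exact: w'desc|apply: parab_vert; exact: U'A].
have Uinf u v : u \in U -> v \in U -> dg_edge u v -> dg_m u v <> None.
  move=> Uu Uv uv m.
  exact: (infinite_edge_descent uv m (wdesc u Uu) (wdesc v Uv)).
(* A vertex v other than x has a neighbour in U; the finite label of that edge forces order 2. *)
have U2 v : v \in U -> dg_f v = Some 2.
  move=> Uv; have [->//|vx] := eqVneq v x.
  have U'v : v \in U' by rewrite 2!inE vx.
  have [||u [b [vu Ub _ ub]]] := conn [set v]%SET.
  - by rewrite finset.sub1set.
  - by apply/set0Pn; exists v; rewrite inE.
  move: vu; rewrite inE => /eqP uv; subst u.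
  have {}Ub : b \in U.
    by move: Ub; rewrite inE => /orP[/(fintype.subsetP U'sU)//|]; rewrite inE => /eqP->.
  have := Uinf _ _ Ub Uv; rewrite dg_edge_sym => /(_ ub).
  have := dg_f_ge2 v; have := @dg_f_m _ b v; rewrite dg_edge_sym => /(_ ub).
  by case: (dg_f v) => [[|[|[|k]]]|] //= H _; rewrite H.
have Uw : parab U w by apply: gen_byM => //; exact: parabS U'w'.
have compE : component S (vert x |` verts A) (vert x) = verts U.
  by rewrite component_verts.
split; rewrite compE.
  split=> [u v /and3P[uv /set_mem/vertsP Uu /set_mem/vertsP Uv]|]; first exact: Uinf.
  apply: sub_finite_set (finite_parab_descent U2 wdesc).
  by apply: gen_by_le => y [].
left; split; first by rewrite elt_order_vert.
exists w, w'; split; last by rewrite invgM mulgVK.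
- exact: longest_descent.
- have -> : verts U `\ vert x = verts U'.
    apply/seteqP; split=> [_ [[v Uv <-] vx]|_ [v + <-]].
      exists v => //; apply/setD1P; split=> //; apply/eqP => vE.
      by apply: vx; rewrite vE.
    move=> /setD1P[vx Uv]; split; first by exists v.
    by move=> /vert_inj/eqP; exact/negP.
  apply: longest_descent => // v U'v; apply: U2.
  exact: (fintype.subsetP U'sU).
Qed.

Lemma ribbon_step : ribbon S (verts A) (conj_by j^-1 (verts A)) j^-1.
Proof.
have [|] := boolP (ltn_inf 2 (dg_f x)); first exact: ribbon_step_order_gt2.
have := dg_f_ge2 x; move: ribbon_step_order2.
by case: (dg_f x) => [[|[|[|k]]]|] //= H _ _; exact: H.
Qed.

End RibbonStep.

(** Lengths add in z k = k v, so z is a single syllable, and [conj_syllable_vert] makes it a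
    generator. *)
Lemma conj_vert_parab B k z v : reduced B k -> parab B z -> z * k = k * vert v ->
  exists2 u, u \in B & z = vert u.
Proof.
move=> kB Bz zk; have z1 : z != 1.
  apply: contra_neq (vert_neq1 v) => z1; apply: (mulgI k).
  by rewrite -zk z1 mul1g mulg1.
have lz : (len z <= 1)%N.
  rewrite -(leq_add2r (len k)) -(reduced_lenM kB Bz) zk.
  by rewrite (leq_trans (lenM _ _ _)) // addnC leq_add2r len_vert.
have [u Bu uz] := parab_len1 Bz z1 lz; exists u => //.
apply: conj_syllable_vert uz z1 _ zk.
by rewrite /descent kB ?eqxx //; exact: parab_vert.
Qed.

(** Induction on the length of k. The images of A may be any generators, so the hypothesis passes to
    the remaining factor k' and the image A' of A under the first ribbon. *)
Lemma reduced_ribbon A k : reduced A k ->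
    (forall v, v \in A -> exists u, k^-1 * vert v * k = vert u) ->
  ribbon S (verts A) (conj_by k^-1 (verts A)) k^-1.
Proof.
have [n] := ubnP (len k); elim: n k A => [|n IHn] k A //; rewrite ltnS => lk kA kconj.
have [->|k1] := eqVneq k 1.
  by rewrite invg1 conj_by1; apply: RibbonNil; exact: verts_sub.
have [x _ kx] := exists_descent (@parabT _ _ S k) k1.
have xA : x \notin A.
  by apply: contraL kx => Ax; rewrite /descent kA ?eqxx //; exact: parab_vert.
pose I := (x |: A)%SET; have AI : A \subset I by exact: finset.subsetU1.
have [q [Iq k'I _]] := coset_min I k.
pose k' := q * k; pose j := q^-1; have kE : k = j * k' by rewrite /k' mulKg.
have Ij : parab I j by exact: gen_byV.
(* As N(k') vanishes on D_I, j inherits from k the descent x and the vanishing on D_A. *)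
have jk o t : parab I t -> cocycle o j t = cocycle o k t.
  by move=> It; rewrite kE cocycleM k'I ?addr0 //; exact: gen_byJ.
have jx : descent j x by rewrite /descent jk //; apply: parab_vert; rewrite !inE eqxx.
have jA : reduced A j by move=> o t At; rewrite jk ?kA //; exact: parabS At.
have jconj v : v \in A -> exists2 u, u \in I & j^-1 * vert v * j = vert u.
  move=> Av; have [u ku] := kconj v Av; apply: (conj_vert_parab k'I (v := u)).
    by apply: gen_byJ => //; apply: parab_vert; exact: (fintype.subsetP AI).
  by rewrite -ku kE !gnorm.
pose A' := [set u | [exists v in A, vert u == j^-1 * vert v * j]]%SET.
have A'E : verts A' = conj_by j^-1 (verts A).
  apply/seteqP; split=> [_ [u + <-]|_ [_ [v Av <-] <-]].
    rewrite /= inE => /exists_inP[v Av /eqP uE].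
    by exists (vert v); [exists v|rewrite (invgK j) uE].
  have [u _ uE] := jconj v Av; exists u; last by rewrite (invgK j) uE.
  by rewrite /= inE; apply/exists_inP; exists v; rewrite // uE.
have A'I : A' \subset I.
  apply/fintype.subsetP => u; rewrite inE => /exists_inP[v Av /eqP uE].
  by have [w Iw wE] := jconj v Av; rewrite (vert_inj (etrans uE wE)).
have lk' : (len k' < n)%N.
  rewrite (leq_trans _ lk) // kE (reduced_lenM k'I Ij) -[X in (X < _)%N]add0n ltn_add2r.
  rewrite lt0n; apply: contraNneq (descent_neq1 jx) => /len0->; exact: eqxx.
rewrite [in X in ribbon _ _ _ X]kE [in X in conj_by X _]kE invgM conj_byM.
apply: ribbon_cat (ribbon_step xA Ij jA jx jconj) _.
rewrite -A'E; apply: IHn lk' _ _; first exact: reducedS k'I.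
move=> u; rewrite inE => /exists_inP[v Av /eqP->].
by have [w wE] := kconj v Av; exists w; rewrite -wE kE !gnorm.
Qed.

Lemma vertsE Y : Y `<=` X -> exists A, Y = verts A.
Proof.
move=> YX; exists [set v | vert v \in Y]%SET; apply/seteqP; split=> [y Yy|_ [v + <-]].
  have [v yE] := vert_surj S (YX _ Yy); exists v => //=.
  by rewrite inE -yE; exact/mem_set.
by rewrite /= inE => /set_mem.
Qed.

Lemma elementary_ribbon_conj Y Z r : elementary_ribbon S Y Z r ->
  conj_by r (gen_by Y) = gen_by Z.
Proof.
case=> -[_ [x [_ _ _ _ E]]] //.
by rewrite -E -conj_byM mulgV conj_by1.
Qed.

Lemma ribbon_conj Y Z r : ribbon S Y Z r -> conj_by r (gen_by Y) = gen_by Z.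
Proof.
elim=> [_|Z1 Z2 r1 s1 _ IH /elementary_ribbon_conj E]; first by rewrite conj_by1.
by rewrite conj_byM IH E.
Qed.

End RibbonTheorem.

Theorem theoremB (D : groupType) (X : set D) (S : dyer_system X)
    (Y Y' : set D) (hY : Y `<=` X) (hY' : Y' `<=` X) :
  Conj Y Y' = [set r * h | r in Ribb S Y Y' & h in gen_by Y].
Proof.
apply/seteqP; split=> [g Yg|_ [r Yr [h Yh <-]]]; last first.
  by rewrite /Conj /= conj_byM (conj_by_id Yh); exact: (ribbon_conj Yr).
have [A YE] := vertsE S hY; have [A' Y'E] := vertsE S hY'; subst Y Y'.
have [q [Aq kA kmin]] := coset_min A g^-1.
have : exists k, [/\ reduced (S := S) A k, g = k^-1 * q &
    forall h, parab (S := S) A h -> (len S k <= len S (h * k))%N].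
  exists (q * g^-1); split=> //; first by rewrite invgM invgK mulgVK.
  by move=> h Ah; rewrite mulgA; apply: kmin; exact: gen_byM.
move=> [k [{}kA gE {}kmin]].
have kY : conj_by k^-1 (parab (S := S) A) = parab (S := S) A'.
  by rewrite -[RHS]Yg gE conj_byM (conj_by_id Aq).
(* Elements of D_A' k^-1 have the form k^-1 h with h in D_A, and k^-1 h is as long as h^-1 k; so the
   minimality of k carries over. *)
have kVA' : reduced (S := S) A' k^-1.
  apply: (@reduced_min _ _ S [set: ds_graph S]%SET); first exact: parabT.
  move=> p; rewrite -kY => -[h Ah <-]; rewrite mulgVK -/(len S _) -/(len S _).
  rewrite -[X in (_ <= X)%N]lenV invgM invgK lenV.
  by apply: kmin; exact: gen_byV.
have kconj v : v \in A -> exists2 u, u \in A' & k^-1 * ds_vert v * k = ds_vert (S := S) u.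
  move=> Av; apply: (conj_vert_parab kVA' (v := v)); last by rewrite mulgK.
  by rewrite -kY; exists (ds_vert v); rewrite ?invgK //; exact: parab_vert.
have kA'E : conj_by k^-1 [set ds_vert v | v in [set` A]] =
    [set ds_vert (S := S) v | v in [set` A']].
  have sub : conj_by k^-1 [set ds_vert v | v in [set` A]] `<=`
      [set ds_vert (S := S) v | v in [set` A']].
    move=> _ [_ [v Av <-] <-]; have [u A'u uE] := kconj v Av.
    by exists u; rewrite ?invgK ?uE.
  apply/seteqP; split=> // _ [u A'u <-].
  (* The image of A is a set B of generators with D_B = D_A', and a generator lying in D_B belongs
     to B. *)
  have [B BE] := vertsE S (subset_trans sub hY').
  rewrite BE; apply/vertsP; apply: (@parab_vertE _ _ S).
  rewrite /parab -BE -conj_by_gen_by kY; exact: parab_vert.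
exists k^-1; last by exists q.
rewrite /Ribb /= -kA'E; apply: reduced_ribbon kA _ => v /kconj[u _ uE].
by exists u.
Qed.
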